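(* Let $T$ be a maximal torus of $SL_6(\mathbb{C})$ and let $G_{3,6}$ be the Grassmannian of $3$-dimensional subspaces of $\mathbb{C}^6$. The homogeneous coordinate ring $\bigoplus_{k\ge0}H^0(G_{3,6},\mathcal{L}_{2\varpi_3}^{\otimes k})^T$ of the GIT quotient $T\backslash\backslash(G_{3,6})^{ss}_T(\mathcal{L}_{2\varpi_3})$ is generated (as a $\mathbb{C}$-algebra) by elements of degree at most $2$, where the $k$-th summand has degree $k$.
   Context: All varieties are over $\mathbb{C}$. $G_{3,6}=SL_6/P_{\alpha_3}$, where $P_{\alpha_3}$ is the maximal parabolic subgroup associated to the simple root $\alpha_3$, and $\varpi_3$ is the corresponding fundamental weight. $\mathcal{L}_{\varpi_3}$ is the Plücker line bundle (the restriction of $\mathcal{O}(1)$ under $G_{3,6}\subset\mathbb{P}(\wedge^3\mathbb{C}^6)$) with the linearization coming from the natural action of $SL_6$ on $\wedge^3\mathbb{C}^6$, restricted to $T$; $\mathcal{L}_{2\varpi_3}=\mathcal{L}_{\varpi_3}^{\otimes2}$. $(G_{3,6})^{ss}_T(\mathcal{L}_{2\varpi_3})$ is the open set of semistable points and $T\backslash\backslash(G_{3,6})^{ss}_T(\mathcal{L}_{2\varpi_3})=\mathrm{Proj}\big(\bigoplus_{k\ge0}H^0(G_{3,6},\mathcal{L}_{2\varpi_3}^{\otimes k})^T\big)$ is the GIT quotient (uniform categorical quotient). The line bundle $\mathcal{L}_{2\varpi_3}$ descends to the quotient, and the homogeneous coordinate ring is taken with respect to this descent. *)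

(* Defs.v *)
From HB Require Import structures.
From mathcomp Require Import all_boot all_order all_algebra all_fingroup.
From mathcomp Require Import boolp classical_sets functions reals.
From mathcomp Require Import mpoly complex.

Set Implicit Arguments.
Unset Strict Implicit.
Unset Printing Implicit Defensive.

Import Order.TTheory GRing.Theory Num.Theory.

Local Open Scope classical_set_scope.
Local Open Scope ring_scope.

(** Increasing triples [I 0 < I 1 < I 2] index the standard basis
    [e_(I 0) /\ e_(I 1) /\ e_(I 2)] of the third exterior power of the space
    of column vectors of size 6. *)
Definition increasing (f : {ffun 'I_3 -> 'I_6}) : bool :=
  [forall i : 'I_3, forall j : 'I_3, (i < j)%N ==> (f i < f j)%N].

Definition triple := {f : {ffun 'I_3 -> 'I_6} | increasing f}.

Section Binet.
Variable K : comPzRingType.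

Lemma det_mulmx_ffun (A : 'M[K]_(3, 6)) (U : 'M[K]_(6, 3)) :
  \det (A *m U) =
  \sum_(f : {ffun 'I_3 -> 'I_6}) (\prod_i A i (f i)) * \det (rowsub f U).
Proof.
rewrite /determinant.
under eq_bigr => s _ do under eq_bigr => i _ do rewrite mxE.
under eq_bigr => s _ do rewrite bigA_distr_bigA big_distrr /=.
rewrite exchange_big /=; apply: eq_bigr => f _.
rewrite big_distrr /=; apply: eq_bigr => s _.
rewrite big_split /= mulrCA; congr (_ * (_ * _)).
by apply: eq_bigr => i _; rewrite mxE.
Qed.

Lemma increasing_inj (f : {ffun 'I_3 -> 'I_6}) : increasing f -> injective f.
Proof.
move=> /forallP inc i j fij; apply/val_inj/eqP => /=.
case: (ltngtP i j) => // ij.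
  by have /forallP/(_ j)/implyP/(_ ij) := inc i; rewrite fij ltnn.
by have /forallP/(_ i)/implyP/(_ ij) := inc j; rewrite fij ltnn.
Qed.

Lemma increasing_sorted (f : {ffun 'I_3 -> 'I_6}) :
  increasing f = sorted ltn [seq val (f i) | i <- enum 'I_3].
Proof.
apply/idP/idP => [/forallP inc|srt].
  apply: (@homo_sorted _ _ (fun i => val (f i)) (relpre val ltn)).
    by move=> i j ij; have /forallP/(_ j)/implyP/(_ ij) := inc i.
  by rewrite -sorted_map val_enum_ord; exact: iota_ltn_sorted.
apply/forallP => i; apply/forallP => j; apply/implyP => ij.
have nE (k : 'I_3) : nth 0%N [seq val (f i) | i <- enum 'I_3] k = f k.
  by rewrite (nth_map k) ?size_enum_ord ?ltn_ord // nth_ord_enum.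
have /(_ i j) := sorted_ltn_nth ltn_trans 0%N srt.
by rewrite !inE size_map size_enum_ord !ltn_ord !nE; apply.
Qed.

Definition triple_perm (q : triple * 'S_3) : {ffun 'I_3 -> 'I_6} :=
  [ffun i => val q.1 (q.2 i)].

Lemma triple_perm_injective : injective triple_perm.
Proof.
move=> [[f incf] s] [[g incg] t] /= /ffunP e.
have {}e i : f (s i) = g (t i) by have := e i; rewrite !ffunE.
have efg : f = g.
  have mf i : f i = g (t (s^-1 i)%g) by rewrite -e permKV.
  have mg i : g i = f (s (t^-1 i)%g) by rewrite e permKV.
  have /eq_in_map : [seq val (f i) | i <- enum 'I_3] =
         [seq val (g i) | i <- enum 'I_3].
    apply: (irr_sorted_eq ltn_trans ltnn); rewrite -?increasing_sorted //.
    move=> x; apply/mapP/mapP => -[i _ ->].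
      by exists (t (s^-1 i)%g); rewrite ?mem_enum // mf.
    by exists (s (t^-1 i)%g); rewrite ?mem_enum // mg.
  by move=> h; apply/ffunP => i; apply/val_inj/h; rewrite mem_enum.
subst g; congr (_, _); first exact: val_inj.
by apply/permP => i; apply: (increasing_inj incf); rewrite e.
Qed.

Lemma triple_perm_surj (f : {ffun 'I_3 -> 'I_6}) :
  injective f -> exists q, triple_perm q = f.
Proof.
move=> injf.
pose u : 3.-tuple 'I_6 := [tuple f i | i < 3].
pose leo := fun i j : 'I_6 => (i <= j)%N.
have /tuple_permP[s us] : perm_eq u (sort_tuple leo u).
  by rewrite perm_sym perm_sort.
pose g : {ffun 'I_3 -> 'I_6} := [ffun i => tnth (sort_tuple leo u) i].
have unu : uniq u by rewrite map_inj_uniq ?enum_uniq.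
have incg : increasing g.
  rewrite increasing_sorted map_comp.
  have -> : [seq g i | i <- enum 'I_3] = sort_tuple leo u.
    rewrite -[RHS](map_tnth_enum (sort_tuple leo u)).
    by apply: eq_map => i; rewrite ffunE.
  rewrite ltn_sorted_uniq_leq map_inj_uniq; last exact: val_inj.
  rewrite sort_uniq unu sorted_map /=.
  by apply: sort_sorted => x y; exact: leq_total.
exists (exist _ g incg, s); apply/ffunP => i; rewrite !ffunE /=.
have {}us := val_inj us.
by have := congr1 (fun t => tnth t i) us; rewrite !tnth_mktuple => ->.
Qed.

Lemma Cauchy_Binet (A : 'M[K]_(3, 6)) (U : 'M[K]_(6, 3)) :
  \det (A *m U) =
  \sum_(J : triple) \det (colsub (val J) A) * \det (rowsub (val J) U).
Proof.
rewrite det_mulmx_ffun (bigID (fun f : {ffun _} => injectiveb f)) /=.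
rewrite addrC big1 ?add0r => [|f]; last first.
  move=> /injectivePn[i [j ij fij]].
  rewrite (determinant_alternate ij) ?mulr0 // => k.
  by rewrite !mxE fij.
transitivity (\sum_(q : triple * 'S_3)
   (\prod_i A i (triple_perm q i)) * \det (rowsub (triple_perm q) U)).
  rewrite (eq_bigl (mem (triple_perm @: predT))) ?big_imset /=; last first.
  - move=> f; apply/injectiveP/imsetP => [inj_f|[q _ ->]].
      by have [q <-] := triple_perm_surj inj_f; exists q.
    move=> i j; rewrite !ffunE => /(increasing_inj (valP q.1)).
    exact: perm_inj.
  - by move=> q q' _ _ /triple_perm_injective.
  by apply: eq_bigl => q; rewrite inE.
rewrite -(pair_bigA _ (fun J s => (\prod_i A i (triple_perm (J, s) i)) *
  \det (rowsub (triple_perm (J, s)) U))) /=.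
apply: eq_bigr => J _; rewrite /determinant mulr_suml.
apply: eq_bigr => s _.
have -> : rowsub (triple_perm (J, s)) U = row_perm s (rowsub (val J) U).
  by apply/matrixP => i j; rewrite !mxE ffunE.
rewrite -/(\det _) row_permE det_mulmx det_perm mulrCA mulrA.
by congr (_ * _ * _); apply: eq_bigr => i _; rewrite !mxE ffunE.
Qed.

End Binet.

Section Defs.
Variable R : realType.
Local Notation C := R[i].

Definition ext3 := {ffun triple -> C}.

(** [wedge3 U] is [u_0 /\ u_1 /\ u_2] for the columns [u_j] of [U]; its
    coordinates are the Pluecker coordinates of the column space of [U]. *)
Definition wedge3 (U : 'M[C]_(6, 3)) : ext3 :=
  [ffun I : triple => \det (rowsub (val I) U)].

(** The points of G_{3,6} are the column spaces W of the matrices U of rank 3,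
    and the Pluecker embedding sends W to the line spanned by [wedge3 U].  The
    nonzero vectors of that line are exactly the [wedge3 U'] with U' of rank 3
    and column space W, so [cone] is the affine cone over G_{3,6} in
    P(ext3), without its vertex. *)
Definition cone :=
  {v : ext3 | `[< exists U : 'M[C]_(6, 3), \rank U = 3%N /\ v = wedge3 U >]}.

HB.instance Definition _ := Choice.on cone.

Fact cone_point_proof :
  `[< exists U, \rank U = 3%N /\ wedge3 (pid_mx 3) = wedge3 U >].
Proof. by apply/asboolP; exists (pid_mx 3); rewrite rank_pid_mx. Qed.

(* A base point is needed for the functions on [cone] to be a nonzero ring. *)
HB.instance Definition _ :=
  isPointed.Build cone (exist _ (wedge3 (pid_mx 3)) cone_point_proof).

Definition SL6 := {g : 'M[C]_6 | \det g == 1}.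

(** The natural linear action on the third exterior power, by the 3 x 3 minors
    of [g]; [ext3_act_wedge3] is the usual characterization. *)
Definition ext3_act (g : 'M[C]_6) (v : ext3) : ext3 :=
  [ffun I : triple =>
     \sum_(J : triple) \det (mxsub (val I) (val J) g) * v J].

Lemma ext3_act_wedge3 (g : 'M[C]_6) (U : 'M[C]_(6, 3)) :
  ext3_act g (wedge3 U) = wedge3 (g *m U).
Proof.
apply/ffunP => I; rewrite !ffunE -mul_rowsub_mx Cauchy_Binet.
apply: eq_bigr => J _; rewrite ffunE; congr (\det _ * _).
by apply/matrixP => i j; rewrite !mxE.
Qed.

Fact cone_act_proof (g : SL6) (v : cone) :
  `[< exists U, \rank U = 3%N /\ ext3_act (val g) (val v) = wedge3 U >].
Proof.
case: v => v /= /asboolP[U [rU ->]]; apply/asboolP.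
exists (val g *m U); rewrite ext3_act_wedge3; split=> //.
transitivity (\rank U) => //.
rewrite -mxrank_tr trmx_mul mxrankMfree ?mxrank_tr //.
by rewrite row_free_unit unitmx_tr unitmxE (eqP (valP g)) unitr1.
Qed.

Definition cone_act (g : SL6) (v : cone) : cone :=
  exist _ (ext3_act (val g) (val v)) (cone_act_proof g v).

Definition ext3_eval (P : {mpoly C[#|{: triple}|]}) (v : ext3) : C :=
  P.@[fun i => v (enum_val i)].

(** The fibre at [W] of the tautological bundle O(-1) is the line of [ext3]
    over [W], so the sections over G_{3,6} of the [d]-th tensor power of the
    Pluecker bundle O(1) are the functions on [cone] which are, locally on
    G_{3,6} for the Zariski topology, quotients P / Q of homogeneous
    polynomials with deg P - deg Q = d.  In particular they satisfy
    [s (a v) = a ^ d s v]. *)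
Definition plucker_section (d : nat) (s : cone -> C) : Prop :=
  forall v0 : cone, exists e (P Q : {mpoly C[#|{: triple}|]}),
    [/\ P \is (e + d)%N.-homog, Q \is e.-homog,
        ext3_eval Q (val v0) != 0
      & forall v : cone, ext3_eval Q (val v) != 0 ->
          s v = ext3_eval P (val v) / ext3_eval Q (val v)].

(** An element [g] acts on sections by [s |-> s \o cone_act g^-1]; invariance
    under all [g] in a group does not depend on whether [g] or [g^-1] is
    used. *)
Definition invariant_section (T : set SL6) (d : nat) : set (cone -> C) :=
  [set s | plucker_section d s /\
           forall t, T t -> forall v, s (cone_act t v) = s v].

(** The graded ring of the invariant sections of the powers of
    L := O(1)^2 (tensor square): the coefficient of 'X^k is the component in degree k,
    an invariant section of L^k = O(2 k).  Multiplication of polynomials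
    with coefficients in the ring of functions on [cone] is multiplication of
    sections. *)
Definition coordinate_ring (T : set SL6) : set {poly (cone -> C)} :=
  [set F | forall k, invariant_section T (2 * k)%N F`_k].

Definition homogeneous_element (T : set SL6) (k : nat) :
    set {poly (cone -> C)} :=
  [set s%:P * 'X^k | s in invariant_section T (2 * k)%N].

Definition is_subalgebra (B : set {poly (cone -> C)}) : Prop :=
  [/\ forall c : C, B (cst c)%:P,
      forall F G, B F -> B G -> B (F + G)
    & forall F G, B F -> B G -> B (F * G)].

Definition generated_algebra (S : set {poly (cone -> C)}) :
    set {poly (cone -> C)} :=
  smallest is_subalgebra S.

Definition SL6_eval (p : {mpoly C[(6 * 6)%N]}) (g : SL6) : C :=
  p.@[fun i => mxvec (val g) 0 i].

Definition zariski_closed (T : set SL6) : Prop :=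
  exists S : set {mpoly C[(6 * 6)%N]},
    T = [set g | forall p, S p -> SL6_eval p g = 0].

Definition Gm (r : nat) : set ('I_r -> C) := [set t | forall i, t i != 0].

(* Laurent polynomials *)
Definition regular_on_Gm (r : nat) (f : ('I_r -> C) -> C) : Prop :=
  exists (p : {mpoly C[r]}) (N : nat),
    forall t, Gm t -> f t = p.@[t] / (\prod_i t i) ^+ N.

(** A closed subgroup isomorphic to (G_m)^r as an algebraic group: [phi] is a
    regular homomorphism onto [T] and [psi] its inverse.  As the determinant is
    1 on SL_6, the regular functions on a closed subset are the polynomials in
    the matrix entries. *)
Definition is_torus (T : set SL6) : Prop :=
  zariski_closed T /\
  exists (r : nat) (phi : ('I_r -> C) -> SL6)
         (psi : 'I_r -> {mpoly C[(6 * 6)%N]}),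
    [/\ phi @` @Gm r = T,
        forall t u, Gm t -> Gm u ->
          val (phi (fun i => t i * u i)) = val (phi t) *m val (phi u),
        forall i j, regular_on_Gm (fun t => val (phi t) i j)
      & forall t, Gm t -> forall i, SL6_eval (psi i) (phi t) = t i].

Definition maximal_torus (T : set SL6) : Prop :=
  is_torus T /\ forall T', is_torus T' -> T `<=` T' -> T' = T.

End Defs.

(* Main.v *)
Require Import Defs.
From mathcomp Require Import all_boot all_order all_algebra.
From mathcomp Require Import boolp classical_sets functions reals.
From mathcomp Require Import mpoly complex.
From mathcomp Require Import ring zify.

Set Implicit Arguments.
Unset Strict Implicit.
Unset Printing Implicit Defensive.

Import Order.TTheory GRing.Theory Num.Theory.

Local Open Scope ring_scope.

(** Every maximal torus is conjugate to the diagonal one.  If [phi] parametrizes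
    a torus, all powers of [phi t0], for [t0] a vector of suitable powers of 2,
    are values of one exponential sum with distinct bases, so [phi t0] is
    diagonalizable and a basis that diagonalizes it diagonalizes the torus.

    For the diagonal torus, an invariant section of degree [k] restricts to the
    chart of the matrices [(1; X)], [X] of size 3, as a regular function on an
    affine space, hence a polynomial.  Invariance makes it multihomogeneous of
    degree [k] in each row and column of [X], so by Birkhoff's theorem it is a
    form of degree [k] in the six monomials [x_sigma] of the expansion of
    [det X].  They satisfy one cubic relation, and the five dimensional space of
    combinations of the [x_sigma] with coefficient sum 0 consists of sections of
    degree 1 (products of two complementary Pluecker coordinates).  With [L] the
    determinant and [z] one of the [x_sigma], the cubic reads
    [L z^2 + M z + N = 0] with [M], [N] forms in these five sections.  Write the
    section as a polynomial in [z] and let [X] go to infinity in the direction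
    of the all-ones matrix, that is, towards the boundary of the chart:
    regularity forces the top coefficient to be divisible by [L], so the degree
    in [z] can be lowered to 1, and what remains is a polynomial in the five
    sections of degree 1 and in the section [L z] of degree 2. *)

(** * Algebras of functions and local quotients *)

Section PolynomialFunctions.
Variable K : numClosedFieldType.
Implicit Types (D : Type) (n : nat).

(** Kept abstract because three such algebras occur: polynomials in one variable, polynomials in [n]
    variables, and functions of a 6 x 3 matrix that are polynomial along lines. *)
Definition funalg D (A : (D -> K) -> Prop) : Prop :=
  [/\ forall c, A (fun=> c),
      forall f g, A f -> A g -> A (fun x => f x + g x)
    & forall f g, A f -> A g -> A (fun x => f x * g x)].

Section Closure.
Variables (D : Type) (A : (D -> K) -> Prop) (hA : funalg A).

Lemma funalg_ext f g : A f -> f =1 g -> A g.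
Proof. by move=> Af /funext <-. Qed.

Lemma funalgC c : A (fun=> c). Proof. by case: hA. Qed.

Lemma funalgD f g : A f -> A g -> A (fun x => f x + g x).
Proof. by case: hA => _ h _; apply: h. Qed.

Lemma funalgM f g : A f -> A g -> A (fun x => f x * g x).
Proof. by case: hA => _ _; apply. Qed.

Lemma funalgN f : A f -> A (fun x => - f x).
Proof.
move=> Af; apply: funalg_ext (funalgM (funalgC (-1)) Af) _ => x.
by rewrite mulN1r.
Qed.

Lemma funalgB f g : A f -> A g -> A (fun x => f x - g x).
Proof. by move=> Af /funalgN; apply: funalgD. Qed.

Lemma funalg_sum (I : eqType) (r : seq I) (P : pred I) (F : I -> D -> K) :
  (forall i, A (F i)) -> A (fun x => \sum_(i <- r | P i) F i x).
Proof.
move=> AF; elim: r => [|i r IH].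
  by apply: funalg_ext (funalgC 0) _ => x; rewrite big_nil.
have [Pi|nPi] := boolP (P i).
  by apply: funalg_ext (funalgD (AF i) IH) _ => x; rewrite big_cons Pi.
by apply: funalg_ext IH _ => x; rewrite big_cons (negPf nPi).
Qed.

Lemma funalg_prod (I : eqType) (r : seq I) (P : pred I) (F : I -> D -> K) :
  (forall i, A (F i)) -> A (fun x => \prod_(i <- r | P i) F i x).
Proof.
move=> AF; elim: r => [|i r IH].
  by apply: funalg_ext (funalgC 1) _ => x; rewrite big_nil.
have [Pi|nPi] := boolP (P i).
  by apply: funalg_ext (funalgM (AF i) IH) _ => x; rewrite big_cons Pi.
by apply: funalg_ext IH _ => x; rewrite big_cons (negPf nPi).
Qed.

Lemma funalgX f e : A f -> A (fun x => f x ^+ e).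
Proof.
move=> Af; elim: e => [|e IH]; first exact: funalgC.
by apply: funalg_ext (funalgM Af IH) _ => x; rewrite exprS.
Qed.

Lemma funalg_meval n (P : {mpoly K[n]}) (u : D -> 'I_n -> K) :
  (forall i, A (u^~ i)) -> A (fun x => P.@[u x]).
Proof.
move=> Au; apply: (@funalg_ext (fun x =>
  \sum_(m <- msupp P) P@_m * \prod_i u x i ^+ m i)) => [|x]; last first.
  by rewrite mevalE.
apply: funalg_sum => m; apply: funalgM; first exact: funalgC.
by apply: funalg_prod => i; apply: funalgX.
Qed.

Lemma funalg_det n (M : D -> 'M[K]_n) :
  (forall i j, A (fun x => M x i j)) -> A (fun x => \det (M x)).
Proof.
move=> AM; apply: funalg_sum => s; apply: funalgM; first exact: funalgC.
by apply: funalg_prod => i; apply: AM.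
Qed.

Lemma funalg_mulmx m n p (M : D -> 'M[K]_(m, n)) (N : D -> 'M[K]_(n, p)) :
  (forall i j, A (fun x => M x i j)) -> (forall i j, A (fun x => N x i j)) ->
  forall i j, A (fun x => (M x *m N x) i j).
Proof.
move=> AM AN i j.
apply: (@funalg_ext (fun x => \sum_k M x i k * N x k j)) => [|x]; last first.
  by rewrite mxE.
by apply: funalg_sum => k; apply: funalgM.
Qed.

End Closure.

(** The local shape of [plucker_section], with numerators and denominators from any algebra; values
    of [g] outside [W] are unconstrained. *)
Definition locquot D (A : (D -> K) -> Prop) (W : D -> Prop) (g : D -> K) :=
  forall x0, W x0 -> exists P Q, [/\ A P, A Q, Q x0 != 0 &
    forall x, W x -> Q x != 0 -> g x = P x / Q x].

Lemma funalg_locquot D (A : (D -> K) -> Prop) W g :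
  funalg A -> A g -> locquot A W g.
Proof.
move=> hA Ag x0 _; exists g, (fun=> 1); split=> //.
- exact: funalgC.
- exact: oner_neq0.
- by move=> x _ _; rewrite divr1.
Qed.

Lemma locquot_comp D D' (A : (D -> K) -> Prop) (A' : (D' -> K) -> Prop)
    (W : D -> Prop) (W' : D' -> Prop) (u : D' -> D) g :
  (forall f, A f -> A' (f \o u)) -> (forall x, W' x -> W (u x)) ->
  locquot A W g -> locquot A' W' (g \o u).
Proof.
move=> AA' WW' h x0 /WW'/h[P [Q [AP AQ Q0 PQ]]].
exists (P \o u), (Q \o u); split; [exact: AA'|exact: AA'|by []|].
by move=> x /WW' Wx Qx; apply: PQ.
Qed.

Definition funalg_domain D (A : (D -> K) -> Prop) : Prop :=
  forall f g, A f -> A g -> (forall x, f x * g x = 0) ->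
  (forall x, f x = 0) \/ (forall x, g x = 0).

Lemma locquot_dense D (A : (D -> K) -> Prop) W (g h : D -> K) q x1 :
  funalg A -> funalg_domain A -> locquot A W g -> locquot A W h ->
  A q -> (forall x, q x != 0 -> W x) -> q x1 != 0 ->
  (forall x, q x != 0 -> g x = h x) -> forall x, W x -> g x = h x.
Proof.
move=> hA dA hg hh Aq qW q1 gh x0 Wx0.
have [P [Q [AP AQ Q0 PQ]]] := hg _ Wx0.
have [P' [Q' [AP' AQ' Q'0 PQ']]] := hh _ Wx0.
rewrite (PQ _ Wx0 Q0) (PQ' _ Wx0 Q'0); apply/eqP.
rewrite eqr_div // -subr_eq0; apply/eqP.
have AF : A (fun x => P x * Q' x - P' x * Q x).
  by apply: (funalgB hA); apply: (funalgM hA).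
have QQ x : Q x * Q' x * q x * (P x * Q' x - P' x * Q x) = 0.
  have [->|qx] := eqVneq (q x) 0; first by rewrite mulr0 mul0r.
  have [->|Qx] := eqVneq (Q x) 0; first by rewrite !mul0r.
  have [->|Q'x] := eqVneq (Q' x) 0; first by rewrite mulr0 !mul0r.
  have Wx := qW _ qx; have := gh _ qx.
  rewrite (PQ _ Wx Qx) (PQ' _ Wx Q'x) => /eqP.
  by rewrite eqr_div // => /eqP->; rewrite subrr mulr0.
have AQQ : A (fun x => Q x * Q' x) by apply: (funalgM hA).
case: (dA _ _ (funalgM hA AQQ Aq) AF QQ) => [QQq|->//].
case: (dA _ _ AQQ Aq QQq) => [/(_ x0)/eqP|/(_ x1)/eqP].
  by rewrite mulf_eq0 (negPf Q0) (negPf Q'0).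
by rewrite (negPf q1).
Qed.

End PolynomialFunctions.

(** * Polynomial functions and regular functions on the line *)

Section RegularFunctions.
Variable K : numClosedFieldType.

Definition polyfun1 (f : K -> K) : Prop := exists p : {poly K}, forall x, f x = p.[x].

Definition polyfun n (f : ('I_n -> K) -> K) : Prop :=
  exists G : {mpoly K[n]}, forall x, f x = G.@[x].

Lemma polyfun1_alg : funalg polyfun1.
Proof.
split=> [c|f g [p hp] [q hq]|f g [p hp] [q hq]].
- by exists c%:P => x; rewrite hornerC.
- by exists (p + q) => x; rewrite hornerD hp hq.
- by exists (p * q) => x; rewrite hornerM hp hq.
Qed.

Lemma polyfun1_id : polyfun1 id.
Proof. by exists 'X => x; rewrite hornerX. Qed.

Lemma polyfun_alg n : funalg (@polyfun n).
Proof.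
split=> [c|f g [p hp] [q hq]|f g [p hp] [q hq]].
- by exists c%:MP => x; rewrite mevalC.
- by exists (p + q) => x; rewrite mevalD hp hq.
- by exists (p * q) => x; rewrite mevalM hp hq.
Qed.

Lemma polyfun_var n i : polyfun (fun x : 'I_n -> K => x i).
Proof. by exists 'X_i => x; rewrite mevalXU. Qed.

(** In characteristic 0 the natural numbers provide more roots of [r * (p - q)] than its degree
    allows. *)
Lemma poly_eq_infinite (p q : {poly K}) (r : {poly K}) :
  r != 0 -> (forall x, r.[x] != 0 -> p.[x] = q.[x]) -> p = q.
Proof.
move=> r0 pq; apply/eqP; rewrite -subr_eq0.
have : r * (p - q) == 0.
  apply/eqP/(roots_geq_poly_eq0 (rs := [seq i%:R | i <- iota 0 (size (r * (p - q)))])).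
  - apply/allP => x _; rewrite rootE hornerM hornerD hornerN.
    have [->|/pq->] := eqVneq r.[x] 0; first by rewrite mul0r.
    by rewrite subrr mulr0.
  - by rewrite map_inj_uniq ?iota_uniq //; apply: mulrIn; exact: oner_neq0.
  - by rewrite size_map size_iota.
by rewrite mulf_eq0 (negPf r0).
Qed.

Lemma polyfun1_domain : funalg_domain polyfun1.
Proof.
move=> f g [p hp] [q hq] fg.
have /eqP : p * q = 0.
  apply: (@poly_eq_infinite _ _ 1); first exact: oner_neq0.
  by move=> x _; rewrite hornerM -hp -hq fg horner0.
by rewrite mulf_eq0 => /orP[]/eqP h; [left|right] => x;
  rewrite ?hp ?hq h horner0.
Qed.

(* Two points are joined by a line, along which the one-variable case applies. *)
Lemma line_domain (V : lmodType K) (A : (V -> K) -> Prop) :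
  (forall f a b, A f -> polyfun1 (fun t => f (a + t *: b))) -> funalg_domain A.
Proof.
move=> hA f g Af Ag fg.
have [|/existsNP[a fa]] := pselect (forall x, f x = 0); first by left.
have [|/existsNP[b gb]] := pselect (forall x, g x = 0); first by right.
have [] := polyfun1_domain (hA _ a (b - a) Af) (hA _ a (b - a) Ag).
- by move=> t; apply: fg.
- by move=> /(_ 0); rewrite scale0r addr0.
- by move=> /(_ 1); rewrite scale1r addrC subrK.
Qed.

Lemma polyfun_domain n : funalg_domain (@polyfun n).
Proof.
move=> f g Af Ag fg.
pose rf (h : ('I_n -> K) -> K) (u : 'rV[K]_n) := h (u 0).
have rE (h : ('I_n -> K) -> K) x : h x = rf h (\row_i x i).
  by rewrite /rf; congr h; apply/funext => i; rewrite mxE.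
pose A' (F : 'rV[K]_n -> K) := exists2 h, polyfun h & F = rf h.
have dA' : funalg_domain A'.
  apply: line_domain => F a b [h [G hG] ->].
  apply: (funalg_ext (f := fun t => G.@[(a + t *: b) 0])) => [|t]; last first.
    by rewrite /rf hG.
  apply: (funalg_meval polyfun1_alg) => i.
  by exists ((a 0 i)%:P + 'X * (b 0 i)%:P) => t; rewrite !mxE !hornerE.
case: (dA' (rf f) (rf g)) => [|||h|h].
- by exists f.
- by exists g.
- by move=> u; apply: fg.
- by left=> x; rewrite rE.
- by right=> x; rewrite rE.
Qed.

(* In lowest terms, a root of the denominator would be a pole. *)
Lemma regular_line (g : K -> K) :
  locquot polyfun1 (fun=> True) g -> polyfun1 g.
Proof.
move=> hg; have [P0 [Q0 [[p hp] [q hq] q0 pq]]] := hg 0 I.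
have qn0 : q != 0 by apply: contraNneq q0 => e; rewrite hq e horner0.
pose d := gcdp p q; pose p1 := p %/ d; pose q1 := q %/ d.
have dp : p = p1 * d by rewrite divpK // dvdp_gcdl.
have dq : q = q1 * d by rewrite divpK // dvdp_gcdr.
have dn0 : d != 0 by apply: contraNneq qn0; rewrite dq => ->; rewrite mulr0.
have q1n0 : q1 != 0 by apply: contraNneq qn0; rewrite dq => ->; rewrite mul0r.
have cop : coprimep p1 q1 by apply: coprimep_div_gcd; rewrite qn0 orbT.
have gq1 x : q1.[x] != 0 /\ g x * q1.[x] = p1.[x].
  have [P1 [Q1 [[a ha] [b hb] b0 ab]]] := hg x I.
  have bn0 : b != 0 by apply: contraNneq b0 => e; rewrite hb e horner0.
  have E : a * q1 = p1 * b.
    apply: (@poly_eq_infinite _ _ (b * q)); first by rewrite mulf_neq0.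
    move=> y; rewrite hornerM mulf_eq0 negb_or => /andP[by0 qy0].
    have := pq y I; rewrite hq hp => /(_ qy0).
    rewrite ab ?hb // ha => /eqP; rewrite eqr_div // dp dq !hornerM mulrA.
    have dy0 : d.[y] != 0.
      by apply: contraNneq qy0; rewrite dq hornerM => ->; rewrite mulr0.
    move=> e; apply: (mulIf dy0); move/eqP: e => e; rewrite e; ring.
  have Ex := congr1 (fun r => r.[x]) E; rewrite !hornerM in Ex.
  rewrite hb in b0.
  have q1x : q1.[x] != 0.
    apply/negP => /eqP q1x; have : root p1 x.
      move/eqP: Ex; rewrite q1x mulr0 eq_sym mulf_eq0 (negPf b0) orbF.
      by rewrite rootE.
    by move=> /(coprimep_root cop); rewrite q1x eqxx.
  split=> //; rewrite ab ?hb // ha.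
  by rewrite mulrAC Ex mulfK.
have q1C : size q1 == 1%N.
  apply/negPn/negP => /closed_rootP[x]; rewrite rootE.
  by have [/negPf->] := gq1 x.
have [c cn0 q1E] := size_poly1P q1 q1C.
exists (c^-1 *: p1) => x; have [_] := gq1 x; rewrite q1E hornerC hornerZ => <-.
by rewrite mulrC mulfK.
Qed.

End RegularFunctions.

(** * Regular functions on affine space *)

Section RegularAffine.
Variable K : numClosedFieldType.

Definition fcons n (c : K) (x : 'I_n -> K) : 'I_n.+1 -> K :=
  fun i => oapp x c (unlift ord0 i).

Lemma fcons0 n c (x : 'I_n -> K) : fcons c x ord0 = c.
Proof. by rewrite /fcons unlift_none. Qed.

Lemma fcons_lift n c (x : 'I_n -> K) i : fcons c x (lift ord0 i) = x i.
Proof. by rewrite /fcons liftK. Qed.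

Lemma fcons_eta n (x : 'I_n.+1 -> K) : x = fcons (x ord0) (x \o lift ord0).
Proof.
by apply/funext => i; rewrite /fcons; case: unliftP => [j|] ->.
Qed.

(** The size bound does not depend on [x], so that [regular_affine] can fix its number of
    interpolation nodes in advance. *)
Lemma meval_fcons n (G : {mpoly K[n.+1]}) (x : 'I_n -> K) :
  exists2 p : {poly K}, (size p <= msize G)%N & forall c, G.@[fcons c x] = p.[c].
Proof.
exists (\sum_(m <- msupp G) (G@_m * \prod_i x i ^+ m (lift ord0 i))%:P *
   'X^(m ord0)).
  apply: (leq_trans (size_sum _ _ _)); rewrite big_seq.
  apply/bigmax_leqP_seq => m mG _.
  apply: (leq_trans (size_polyMleq _ _)); rewrite size_polyXn addnS /=.
  apply: leq_trans (msize_mdeg_lt mG); rewrite -[(mdeg m).+1]add1n.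
  apply: leq_add; first exact: size_polyC_leq1.
  by rewrite mdegE (bigD1 ord0) //= leq_addr.
move=> c; rewrite mevalE horner_sum; apply: eq_bigr => m _.
rewrite hornerM hornerC hornerXn big_ord_recl fcons0 -mulrA [X in _ = _ * X]mulrC.
by congr (_ * (_ * _)); apply: eq_bigr => i _; rewrite fcons_lift.
Qed.

Lemma poly_interpolation (d : nat) : exists L : 'I_d -> {poly K},
  forall p : {poly K}, (size p <= d)%N ->
  p = \sum_(j < d) p.[j%:R] *: L j.
Proof.
pose q (j : 'I_d) : {poly K} := \prod_(i < d | i != j) ('X - (i%:R)%:P).
have natI : injective (fun i => i%:R : K) by apply: mulrIn; exact: oner_neq0.
have q0 (j i : 'I_d) : i != j -> (q j).[i%:R] = 0.
  by move=> ij; rewrite horner_prod (bigD1 i) //= !hornerE subrr mul0r.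
have qj (j : 'I_d) : (q j).[j%:R] != 0.
  rewrite horner_prod; apply/prodf_neq0 => i ij; rewrite !hornerE subr_eq0.
  by rewrite eq_sym (inj_eq natI).
have sq j : (size (q j) <= d)%N.
  rewrite /q (eq_bigl (mem (predC1 j))) // -big_enum size_prod_XsubC -cardE.
  by rewrite cardC1 card_ord; case: (d) j => [[]|].
exists (fun j => (q j).[j%:R]^-1 *: q j) => p sp.
apply/eqP; rewrite -subr_eq0; apply/eqP.
apply: (roots_geq_poly_eq0 (rs := [seq i%:R | i <- iota 0 d])).
- rewrite all_map; apply/allP => i; rewrite mem_iota /= add0n => id.
  rewrite rootE !hornerE horner_sum (bigD1 (Ordinal id)) //= big1 => [|j ij].
    by rewrite !hornerZ mulVf ?mulr1 ?addr0 ?subrr //; apply: (qj (Ordinal id)).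
  by rewrite !hornerZ (q0 j (Ordinal id)) ?mulr0 // eq_sym.
- by rewrite map_inj_uniq ?iota_uniq.
- rewrite size_map size_iota (leq_trans (size_polyD _ _)) // geq_max sp.
  rewrite size_polyN (leq_trans (size_sum _ _ _)) //; apply/bigmax_leqP => j _.
  by rewrite !(leq_trans (size_scale_leq _ _)).
Qed.

(** Induction on [n]. Globally [Q g = P], so along lines parallel to the first axis [g] is a
    polynomial whose degree is bounded by that of [P]. It is then interpolated from its restrictions
    to finitely many hyperplanes, which are polynomial by induction. *)
Lemma regular_affine n (g : ('I_n -> K) -> K) :
  locquot (@polyfun K n) (fun=> True) g -> polyfun g.
Proof.
elim: n g => [|n IH] g hg.
  exists (g (fun=> 0))%:MP => x; rewrite mevalC; congr g.
  by apply/funext => -[].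
pose x0 : 'I_n.+1 -> K := fun=> 0.
have [P0 [Q0 [[P hP] AQ0 Q00 PQ0]]] := hg x0 I.
have [Q hQ] := AQ0.
have lineP x : polyfun1 (fun c => g (fcons c x)).
  apply: regular_line; apply: (locquot_comp _ _ hg) => // f [F hF].
  by have [p _ hp] := meval_fcons F x; exists p => c /=; rewrite hF hp.
have hypP a : polyfun (fun x => g (fcons a x)).
  apply: IH; apply: (locquot_comp _ _ hg) => // f [F hF].
  apply: (funalg_ext (f := fun x => F.@[fcons a x])) => [|x]; last first.
    by rewrite /= hF.
  apply: (funalg_meval (polyfun_alg _ _)) => i; rewrite /fcons.
  case: unliftP => [j _|_] /=; first exact: polyfun_var.
  exact: funalgC (polyfun_alg _ _) _.
have Qg x : Q.@[x] * g x = P.@[x].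
  apply: (@locquot_dense _ _ (@polyfun K n.+1) (fun=> True)
    (fun x => Q.@[x] * g x) (fun x => P.@[x]) Q0 x0) => //.
  - exact: polyfun_alg.
  - exact: polyfun_domain.
  - move=> y _; have [P1 [Q1 [AP1 AQ1 Q10 PQ1]]] := hg y I.
    exists (fun x => Q0 x * P1 x), Q1; split=> //.
      exact: (funalgM (polyfun_alg _ _)).
    by move=> z _ Qz; rewrite PQ1 // -hQ mulrA.
  - by apply: (funalg_locquot (polyfun_alg _ _)); exists P.
  - by move=> y Qy; rewrite PQ0 // -hP -hQ mulrC divfK.
have [L hL] := poly_interpolation (msize P).
pose G (x : 'I_n.+1 -> K) :=
  \sum_(j < msize P) g (fcons j%:R (x \o lift ord0)) * (L j).[x ord0].
have AG : polyfun G.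
  apply: (funalg_sum (polyfun_alg _ _)) => j.
  apply: (funalgM (polyfun_alg _ _)).
    have [F hF] := hypP j%:R.
    apply: (funalg_ext (f := fun x : 'I_n.+1 -> K => F.@[x \o lift ord0])) => [|x].
      apply: (funalg_meval (polyfun_alg _ _)) => i; exact: polyfun_var.
    by rewrite hF.
  apply: (funalg_ext (f := fun x : 'I_n.+1 -> K =>
     \sum_(i < size (L j)) (L j)`_i * x ord0 ^+ i)) => [|x]; last first.
    by rewrite horner_coef.
  apply: (funalg_sum (polyfun_alg _ _)) => i.
  apply: (funalgM (polyfun_alg _ _)); first exact: funalgC (polyfun_alg _ _) _.
  by apply: (funalgX (polyfun_alg _ _)); exact: polyfun_var.
suff gG x : g x = G x by have [F hF] := AG; exists F => x; rewrite gG hF.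
(* The degree bound on a line requires that [Q] not vanish identically there. This is clear through
   points where [Q0] is nonzero, and density extends the equality. *)
apply: (@locquot_dense _ _ (@polyfun K n.+1) (fun=> True) g G Q0 x0) => //.
- exact: polyfun_alg.
- exact: polyfun_domain.
- exact: funalg_locquot (polyfun_alg _ _) AG.
move=> {}x Qx; rewrite /G [x in LHS]fcons_eta.
set c := x ord0; set y := x \o lift ord0.
have [p hp] := lineP y.
have [q _ hq] := meval_fcons Q y; have [r sr hr] := meval_fcons P y.
have qp : q * p = r.
  apply: (@poly_eq_infinite _ _ _ 1) => [|a _]; first exact: oner_neq0.
  by rewrite hornerM -hq -hp -hr Qg.
have qn0 : q != 0.
  by apply: contraNneq Qx => q0; rewrite hQ [x]fcons_eta hq q0 horner0.
have sp : (size p <= msize P)%N.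
  have [->|pn0] := eqVneq p 0; first by rewrite size_poly0.
  apply: leq_trans sr; rewrite -qp size_mul //.
  by move: qn0; rewrite -size_poly_gt0; case: (size q) => // k _; rewrite addSn leq_addl.
rewrite hp [p in LHS](hL p sp) horner_sum.
by apply: eq_bigr => j _; rewrite hornerZ hp.
Qed.

End RegularAffine.

(** * Torus weights and Birkhoff's theorem for 3 x 3 exponent matrices *)

Section MagicMonomials.
Variable K : numClosedFieldType.

Definition monomial (m : 'M[nat]_3) (X : 'M[K]_3) : K :=
  \prod_i \prod_j X i j ^+ m i j.

Definition monomial_span (Q : 'M[nat]_3 -> Prop) (g : 'M[K]_3 -> K) : Prop :=
  exists s : seq (K * 'M[nat]_3), (forall p, p \in s -> Q p.2) /\
    forall X, g X = \sum_(p <- s) p.1 * monomial p.2 X.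

Lemma polyfun_monomial_span (g : 'M[K]_3 -> K) :
  polyfun (fun v : 'I_(3 * 3) -> K => g (vec_mx (\row_i v i))) ->
  monomial_span (fun=> True) g.
Proof.
move=> [G hG]; exists [seq (G@_m, \matrix_(i, j) m (mxvec_index i j)) |
  m : 'X_{1.. 3 * 3} <- msupp G]; split=> // X.
rewrite big_map -[X in LHS]mxvecK.
have -> : mxvec X = \row_i mxvec X 0 i by apply/rowP => i; rewrite mxE.
rewrite hG mevalE; apply: eq_bigr => m _; congr (_ * _); rewrite /monomial.
rewrite (reindex _ (curry_mxvec_bij 3 3)) /= pair_bigA /=.
by apply: eq_bigr => -[i j] _ /=; rewrite mxvecE mxE.
Qed.

Definition weight (w m : 'M[nat]_3) : nat := (\sum_i \sum_j w i j * m i j)%N.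

Lemma monomial_scale (z : K) (w m : 'M[nat]_3) (X : 'M[K]_3) :
  monomial m (\matrix_(i, j) (z ^+ w i j * X i j)) =
  z ^+ weight w m * monomial m X.
Proof.
rewrite /monomial /weight expr_sum -big_split /=; apply: eq_bigr => i _.
rewrite expr_sum -big_split /=; apply: eq_bigr => j _.
by rewrite mxE exprMn exprM.
Qed.

(** For fixed [X] both sides are polynomials in [z], and only monomials of weight [k] contribute to
    the coefficient of [z ^+ k]. *)
Lemma monomial_span_weight Q (w : 'M[nat]_3) k (g : 'M[K]_3 -> K) :
  (forall z (X : 'M[K]_3), z != 0 -> g (\matrix_(i, j) (z ^+ w i j * X i j)) = z ^+ k * g X) ->
  monomial_span Q g -> monomial_span (fun m => Q m /\ weight w m = k) g.
Proof.
move=> hw [s [Qs hg]]; exists [seq p <- s | weight w p.2 == k]; split.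
  by move=> p; rewrite mem_filter => /andP[/eqP wp /Qs].
move=> X; rewrite big_filter.
pose P := \sum_(p <- s) (p.1 * monomial p.2 X) *: 'X^(weight w p.2).
have PE : P = g X *: 'X^k.
  apply: (@poly_eq_infinite _ _ _ 'X) => [|z]; first by rewrite polyX_eq0.
  rewrite hornerX => z0; rewrite hornerZ hornerXn mulrC -hw // hg horner_sum.
  apply: eq_bigr => p _; rewrite hornerZ hornerXn monomial_scale.
  by rewrite -mulrA [X in _ * X = _]mulrC.
have := congr1 (fun p : {poly K} => p`_k) PE.
rewrite coefZ coefXn eqxx mulr1 => <-; rewrite coef_sum [RHS]big_mkcond /=.
apply: eq_bigr => p _; rewrite coefZ coefXn eq_sym.
by case: ifP => _; rewrite ?mulr1 ?mulr0.
Qed.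

Lemma monomial_span_sub Q Q' g : (forall m, Q m -> Q' m) ->
  monomial_span Q g -> monomial_span Q' g.
Proof. by move=> QQ' [s [Qs hg]]; exists s; split=> // p /Qs/QQ'. Qed.

Definition magic (k : nat) (m : 'M[nat]_3) : Prop :=
  (forall i, \sum_j m i j = k)%N /\ (forall j, \sum_i m i j = k)%N.

Lemma monomial_span_magic k (g : 'M[K]_3 -> K) :
  (forall i z (X : 'M[K]_3), z != 0 ->
     g (\matrix_(a, b) (z ^+ (a == i) * X a b)) = z ^+ k * g X) ->
  (forall j z (X : 'M[K]_3), z != 0 ->
     g (\matrix_(a, b) (z ^+ (b == j) * X a b)) = z ^+ k * g X) ->
  monomial_span (fun=> True) g -> monomial_span (magic k) g.
Proof.
move=> hr hc hg.
pose wr (i : 'I_3) : 'M[nat]_3 := \matrix_(a, b) (a == i : nat).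
pose wc (j : 'I_3) : 'M[nat]_3 := \matrix_(a, b) (b == j : nat).
have step Q w : (exists i, w = wr i \/ w = wc i) -> monomial_span Q g ->
    monomial_span (fun m => Q m /\ weight w m = k) g.
  move=> hw; apply: monomial_span_weight => z X z0.
  case: hw => i [->|->]; [rewrite -(hr i z X z0)|rewrite -(hc i z X z0)];
    by congr g; apply/matrixP => a b; rewrite !mxE.
have [ew] : exists ws : seq 'M[nat]_3,
  (forall w, w \in ws -> exists i, w = wr i \/ w = wc i) /\
  (forall i, wr i \in ws /\ wc i \in ws).
  exists ([seq wr i | i : 'I_3] ++ [seq wc i | i : 'I_3]); split.
    by move=> w; rewrite mem_cat => /orP[] /codomP[i ->]; exists i; [left|right].
  by move=> i; rewrite !mem_cat !codom_f orbT.
move=> [ew1 ew2].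
have : monomial_span (fun m => forall w, w \in ew -> weight w m = k) g.
  elim: (ew) ew1 => [|w ws IH] hws; first exact: monomial_span_sub hg.
  have := IH (fun w' h => hws w' (mem_behead (s := w :: ws) h)).
  move=> /(step _ w (hws w (mem_head _ _))).
  apply: monomial_span_sub => m [h1 h2] w'; rewrite inE => /orP[/eqP->//|].
  exact: h1.
apply: monomial_span_sub => m hm; split=> i.
  rewrite -(hm _ (ew2 i).1) /weight [RHS](bigD1 i) //= [X in (_ + X)%N]big1.
    by rewrite addn0; apply: eq_bigr => j _; rewrite mxE eqxx mul1n.
  by move=> a ai; rewrite big1 // => j _; rewrite mxE (negPf ai).
rewrite -(hm _ (ew2 i).2) /weight; apply: eq_bigr => a _.
rewrite [RHS](bigD1 i) //= mxE eqxx mul1n big1 ?addn0 // => j ji.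
by rewrite mxE (negPf ji).
Qed.

(* The monomials of the even (a) and odd (b) permutations. *)
Definition a1 (X : 'M[K]_3) := X 0 0 * X 1 1 * X 2 2.
Definition a2 (X : 'M[K]_3) := X 0 1 * X 1 2 * X 2 0.
Definition a3 (X : 'M[K]_3) := X 0 2 * X 1 0 * X 2 1.
Definition b1 (X : 'M[K]_3) := X 0 0 * X 1 2 * X 2 1.
Definition b2 (X : 'M[K]_3) := X 0 1 * X 1 0 * X 2 2.
Definition b3 (X : 'M[K]_3) := X 0 2 * X 1 1 * X 2 0.

Lemma sum3 (F : 'I_3 -> nat) : (\sum_i F i = F 0%R + F 1%R + F 2%R)%N.
Proof.
rewrite !big_ord_recl big_ord0 addn0 addnA.
by congr (_ + F _ + F _)%N; apply/val_inj.
Qed.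

Lemma prod3 (F : 'I_3 -> K) : \prod_i F i = F 0 * F 1 * F 2.
Proof.
rewrite !big_ord_recl big_ord0 mulr1 mulrA.
by congr (_ * F _ * F _); apply/val_inj.
Qed.

Lemma birkhoff3 (m00 m01 m02 m10 m11 m12 m20 m21 m22 k : nat) :
  (m00 + m01 + m02 = k -> m10 + m11 + m12 = k -> m20 + m21 + m22 = k ->
  m00 + m10 + m20 = k -> m01 + m11 + m21 = k -> m02 + m12 + m22 = k ->
  exists n1 n2 n3 n4 n5 n6, n1 + n2 + n3 + n4 + n5 + n6 = k /\
  [/\ m00 = n1 + n4, m01 = n2 + n5 & m02 = n3 + n6] /\
  [/\ m10 = n3 + n5, m11 = n1 + n6 & m12 = n2 + n4] /\
  [/\ m20 = n2 + n6, m21 = n3 + n4 & m22 = n1 + n5])%N.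
Proof.
move=> r0 r1 r2 c0 c1 c2.
(* [t] is the multiplicity of [b1], which determines the other five. Those of [b2] and [b3] are
   nonnegative when [t] is at least both differences; truncation also makes [t] nonnegative, and the
   least such [t] meets the upper bounds [m00], [m12], [m21]. *)
pose t := maxn (m12 - m01)%N (m00 - m11)%N.
exists (m00 - t)%N, (m12 - t)%N, (m21 - t)%N, t, (m01 + t - m12)%N,
  (m11 + t - m00)%N.
by do !split; lia.
Qed.

Lemma monomial_magic k m : magic k m -> exists n1 n2 n3 n4 n5 n6,
  (n1 + n2 + n3 + n4 + n5 + n6 = k)%N /\ forall X, monomial m X =
   a1 X ^+ n1 * a2 X ^+ n2 * a3 X ^+ n3 * b1 X ^+ n4 * b2 X ^+ n5 * b3 X ^+ n6.
Proof.
move=> [hr hc].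
have := hr 0; have := hr 1; have := hr 2.
have := hc 0; have := hc 1; have := hc 2.
rewrite !sum3 => c2 c1 c0 r2 r1 r0.
have [n1 [n2 [n3 [n4 [n5 [n6 [nk [[e00 e01 e02] [[e10 e11 e12] [e20 e21 e22]]]]]]]]]]
  := birkhoff3 r0 r1 r2 c0 c1 c2.
exists n1, n2, n3, n4, n5, n6; split=> // X.
rewrite /monomial !prod3 e00 e01 e02 e10 e11 e12 e20 e21 e22 !exprD.
rewrite /a1 /a2 /a3 /b1 /b2 /b3 !exprMn.
ring.
Qed.

End MagicMonomials.

(** * Weighted forms in a family of functions *)

Section GradedFunctions.
Variables (K : numClosedFieldType) (D : Type).
Variable V : nat -> (D -> K) -> Prop.

(** The degree is carried by the derivation and not read off from the function; 0 has every
    degree. *)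
Inductive graded : nat -> (D -> K) -> Prop :=
| graded0 e : graded e (fun=> 0)
| gradedC c : graded 0 (fun=> c)
| graded_gen e f : V e f -> graded e f
| gradedD e f g : graded e f -> graded e g -> graded e (fun x => f x + g x)
| gradedM e e' f g : graded e f -> graded e' g ->
    graded (e + e') (fun x => f x * g x).

Lemma graded_ext e f g : graded e f -> f =1 g -> graded e g.
Proof. by move=> hf /funext <-. Qed.

Lemma gradedZ e c f : graded e f -> graded e (fun x => c * f x).
Proof. exact: gradedM (gradedC c). Qed.

Lemma gradedB e f g : graded e f -> graded e g -> graded e (fun x => f x - g x).
Proof.
move=> hf /(gradedZ (-1)) hg; apply: graded_ext (gradedD hf hg) _ => x.
by rewrite mulN1r.
Qed.

End GradedFunctions.

(** * The cubic relation between the six monomials *)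

Section SegreCubic.
Variable K : numClosedFieldType.
Implicit Types (X : 'M[K]_3) (f g h : 'M[K]_3 -> K).

(** Together with [v1, .., v4], a basis of the combinations of the six monomials with coefficient
    sum 0. *)
Definition L X := a1 X + a2 X + a3 X - b1 X - b2 X - b3 X.
Definition v1 X := a1 X - b1 X.
Definition v2 X := a2 X - b1 X.
Definition v3 X := b2 X - a1 X.
Definition v4 X := b3 X - a1 X.

Inductive linear_gen : nat -> ('M[K]_3 -> K) -> Prop :=
| gen_L : linear_gen 1 L
| gen_v1 : linear_gen 1 v1
| gen_v2 : linear_gen 1 v2
| gen_v3 : linear_gen 1 v3
| gen_v4 : linear_gen 1 v4.

(** Multiplying [segre_relation] by [L] shows that [y = L b1] satisfies [y^2 + M2 y + L N3 = 0], the
    equation of a double cover of a projective 4-space branched along the quartic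
    [M2^2 - 4 L N3]. *)
Inductive coble_gen : nat -> ('M[K]_3 -> K) -> Prop :=
| gen_linear e f : linear_gen e f -> coble_gen e f
| gen_quadratic : coble_gen 2 (fun X => L X * b1 X).

Local Notation A := (graded linear_gen).

(** Coefficients in [b1] of [a1 a2 a3 - b1 b2 b3] after writing each monomial as [b1] plus a form of
    degree 1: [v1], [v2] and [L + v1 - v2 + v3 + v4] for the even ones, [v1 + v3] and [v1 + v4] for
    [b2] and [b3]. *)
Definition M2 X := v1 X * v2 X + v1 X * (L X + v1 X - v2 X + v3 X + v4 X)
  + v2 X * (L X + v1 X - v2 X + v3 X + v4 X) - (v1 X + v3 X) * (v1 X + v4 X).
Definition N3 X := v1 X * v2 X * (L X + v1 X - v2 X + v3 X + v4 X).

(* The relation [a1 a2 a3 = b1 b2 b3] in the coordinates [L, v1, .., v4, b1]. *)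
Lemma segre_relation X : L X * b1 X ^+ 2 + M2 X * b1 X + N3 X = 0.
Proof.
by rewrite /M2 /N3 /L /v1 /v2 /v3 /v4 /a1 /a2 /a3 /b1 /b2 /b3; ring.
Qed.

Lemma M2_graded : A 2 M2.
Proof.
have ? := graded_gen gen_L; have ? := graded_gen gen_v1.
have ? := graded_gen gen_v2; have ? := graded_gen gen_v3.
have ? := graded_gen gen_v4.
have h : A 1 (fun X => L X + v1 X - v2 X + v3 X + v4 X).
  by do 2![apply: gradedD => //]; apply: gradedB => //; apply: gradedD.
apply: gradedB; last by apply: (@gradedM _ _ _ 1 1); apply: gradedD.
by do 2?[apply: gradedD]; apply: (@gradedM _ _ _ 1 1).
Qed.

Lemma N3_graded : A 3 N3.
Proof.
have ? := graded_gen gen_L; have ? := graded_gen gen_v1.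
have ? := graded_gen gen_v2; have ? := graded_gen gen_v3.
have ? := graded_gen gen_v4.
apply: (@gradedM _ _ _ 2 1); first exact: (@gradedM _ _ _ 1 1).
by do 2![apply: gradedD => //]; apply: gradedB => //; apply: gradedD.
Qed.

(* The functions [\sum_(j <= J) f_j b1 ^+ j] with [f_j] in [A (k - j)]. *)
Fixpoint expansion (J k : nat) (g : 'M[K]_3 -> K) : Prop :=
  if J is J'.+1 then exists g' f e, [/\ expansion J' k g', A e f,
    (e + J = k)%N & forall X, g X = g' X + f X * b1 X ^+ J]
  else A k g.

Lemma expansion_ext J k g h : expansion J k g -> g =1 h -> expansion J k h.
Proof. by move=> hg /funext <-. Qed.

Lemma expansion0 J k : (J <= k)%N -> expansion J k (fun=> 0).
Proof.
elim: J => [|J IH] Jk; first exact: graded0.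
exists (fun=> 0), (fun=> 0), (k - J.+1)%N; split.
- by apply: IH; apply: ltnW.
- exact: graded0.
- by rewrite subnK.
- by move=> X; rewrite mul0r addr0.
Qed.

Lemma expansionD J k g h :
  expansion J k g -> expansion J k h -> expansion J k (fun X => g X + h X).
Proof.
elim: J g h => [|J IH] g h; first exact: gradedD.
move=> [g' [f [e [Eg Af ek gE]]]] [h' [f' [e' [Eh Af' ek' hE]]]].
have ee : e' = e by apply/eqP; rewrite -(eqn_add2r J.+1) ek ek'.
rewrite ee in Af'.
exists (fun X => g' X + h' X), (fun X => f X + f' X), e; split=> //.
- exact: IH.
- exact: gradedD.
- by move=> X; rewrite gE hE; ring.
Qed.

Lemma expansionM J k e f g : A e f -> expansion J k g ->
  expansion J (e + k) (fun X => f X * g X).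
Proof.
move=> Af; elim: J g => [|J IH] g; first exact: gradedM.
move=> [g' [f' [e' [Eg Af' ek gE]]]].
exists (fun X => f X * g' X), (fun X => f X * f' X), (e + e')%N; split=> //.
- exact: IH.
- exact: gradedM.
- by rewrite -addnA ek.
- by move=> X; rewrite gE; ring.
Qed.

Lemma expansion_term J j e k f : A e f -> (e + j = k)%N -> (j <= J <= k)%N ->
  expansion J k (fun X => f X * b1 X ^+ j).
Proof.
move=> Af ejk; elim: J => [|J IH] /andP[jJ Jk].
  move: jJ ejk; rewrite leqn0 => /eqP->; rewrite addn0 => <-.
  by apply: graded_ext Af _ => X; rewrite mulr1.
move: jJ; rewrite leq_eqVlt => /orP[/eqP jJ|jJ].
  exists (fun=> 0), f, e; split=> //.
  - by apply: expansion0; apply: ltnW.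
  - by rewrite -jJ.
  - by move=> X; rewrite add0r jJ.
exists (fun X => f X * b1 X ^+ j), (fun=> 0), (k - J.+1)%N; split.
- by apply: IH; rewrite (ltnW Jk) andbT.
- exact: graded0.
- by rewrite subnK.
- by move=> X; rewrite mul0r addr0.
Qed.

Lemma expansion_b1 J k g : expansion J k g ->
  expansion J.+1 k.+1 (fun X => b1 X * g X).
Proof.
elim: J g => [|J IH] g.
  move=> Ag; exists (fun=> 0), g, k; split=> //.
  - exact: graded0.
  - by rewrite addn1.
  - by move=> X; rewrite add0r mulrC.
move=> [g' [f [e [Eg Af ek gE]]]].
exists (fun X => b1 X * g' X), f, e; split=> //.
- exact: IH.
- by rewrite addnS ek.
- by move=> X; rewrite gE !exprS; ring.
Qed.

Lemma expansion_mono J k g : expansion J k g -> (J < k)%N -> expansion J.+1 k g.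
Proof.
move=> Eg Jk; exists g, (fun=> 0), (k - J.+1)%N; split=> //.
- exact: graded0.
- by rewrite subnK.
- by move=> X; rewrite mul0r addr0.
Qed.

(** Each of the six monomials is [b1] plus a form of degree 1, so multiplying by it raises the total
    degree and the bound on the degree in [b1] by one. *)
Lemma expansion_linear (a v : 'M[K]_3 -> K) : A 1 v -> (forall X, a X = b1 X + v X) ->
  forall k n g, expansion k k g -> expansion (n + k) (n + k) (fun X => a X ^+ n * g X).
Proof.
move=> Av aE k; elim=> [|n IH] g Eg.
  by apply: expansion_ext Eg _ => X; rewrite mul1r.
have {}IH := IH g Eg; rewrite addSn.
apply: (expansion_ext (expansionD (expansion_b1 IH)
  (expansion_mono (expansionM Av IH) _))) => [|X].
  by rewrite add1n.
by rewrite aE exprS; ring.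
Qed.

Lemma magic_expansion k g :
  monomial_span (magic k) g -> expansion k k g.
Proof.
move=> [s [hs hg]].
apply: (expansion_ext (g := fun X => \sum_(p <- s) p.1 * monomial p.2 X)) => [|X];
  last by rewrite hg.
elim: s hs {hg} => [|[c m] s IH] hs.
  by apply: expansion_ext (expansion0 (leqnn k)) _ => X; rewrite big_nil.
have {}IH : expansion k k (fun X => \sum_(p <- s) p.1 * monomial p.2 X).
  by apply: IH => p ps; apply: hs; rewrite inE ps orbT.
have [n1 [n2 [n3 [n4 [n5 [n6 [nk mE]]]]]]] := monomial_magic K (hs _ (mem_head _ _)).
have Am : expansion k k (fun X => c * monomial m X).
  have AL := graded_gen gen_L; have A1 := graded_gen gen_v1.
  have A2 := graded_gen gen_v2; have A3 := graded_gen gen_v3.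
  have A4 := graded_gen gen_v4.
  (* This is the form [a3 - b1]. The powers are now multiplied onto the constant [c] one by one; the
     pending identities [a = b1 + v] are proved together at the end. *)
  have Aa3 := gradedD (gradedD (gradedB (gradedD AL A1) A2) A3) A4.
  have EC : expansion 0 0 (fun=> c) by exact: gradedC.
  have E6 := expansion_linear (a := @b3 K) (gradedD A1 A4) _ n6 EC.
  have E5 := expansion_linear (a := @b2 K) (gradedD A1 A3) _ n5 (E6 _).
  have E4 := expansion_linear (a := @b1 K) (graded0 _ _) _ n4 (E5 _ _).
  have E3 := expansion_linear (a := @a3 K) Aa3 _ n3 (E4 _ _ _).
  have E2 := expansion_linear (a := @a2 K) A2 _ n2 (E3 _ _ _ _).
  have E1 := expansion_linear (a := @a1 K) A1 _ n1 (E2 _ _ _ _ _).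
  rewrite addn0 !addnA nk in E1; apply: (expansion_ext (E1 _ _ _ _ _ _)) => X;
    by rewrite ?mE /L /v1 /v2 /v3 /v4; ring.
apply: expansion_ext (expansionD Am IH) _ => X.
by rewrite big_cons.
Qed.

End SegreCubic.

(** * Pole orders at the boundary of the chart *)

Section PoleOrder.
Variable K : numClosedFieldType.
Implicit Types (X : 'M[K]_3) (f g h : 'M[K]_3 -> K).
Local Notation A := (graded (@linear_gen K)).

(** Chosen so that along [escape] the forms [v1, .., v4] have leading terms [u1, .., u4] times
    [mu ^- 2], while [L] has a pole of order at most 1. *)
Definition offset (u1 u2 u3 u4 : K) : 'M[K]_3 := \matrix_(i, j)
  if (i == 1) && (j == 2%:R) then - u1 else
  if (i == 0) && (j == 1) then u2 else
  if (i == 1) && (j == 0) then u3 - u2 else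
  if (i == 0) && (j == 2%:R) then u4 else 0.

Definition escape u1 u2 u3 u4 mu : 'M[K]_3 :=
  offset u1 u2 u3 u4 + const_mx mu^-1.

Lemma escape_b1 u1 u2 u3 u4 mu : mu != 0 ->
  mu ^+ 3 * b1 (escape u1 u2 u3 u4 mu) = 1 - u1 * mu.
Proof. by move=> mu0; rewrite /b1 !mxE /=; field. Qed.

Lemma escape_graded e f : A e f -> exists c h,
  [/\ A e (fun X => c (v1 X) (v2 X) (v3 X) (v4 X)),
      forall X, f X = c (v1 X) (v2 X) (v3 X) (v4 X) + L X * h X,
      if e is e'.+1 then A e' h else h = fun=> 0 &
      forall u1 u2 u3 u4, exists q : {poly K}, q.[0] = c u1 u2 u3 u4 /\
        forall mu, mu != 0 -> mu ^+ e.*2 * f (escape u1 u2 u3 u4 mu) = q.[mu]].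
Proof.
elim=> {e f} [e|c|e f|e f g _ [c [h [Ac fE Ah cu]]] _ [c' [h' [Ac' fE' Ah' cu']]]|
  e e' f g Af [c [h [Ac fE Ah cu]]] Ag [c' [h' [Ac' fE' Ah' cu']]]].
- exists (fun _ _ _ _ => 0), (fun=> 0); split.
  + exact: graded0.
  + by move=> X; rewrite mulr0 addr0.
  + by case: e => // e; apply: graded0.
  + by move=> *; exists 0; rewrite horner0; split=> // mu _; rewrite mulr0 horner0.
- exists (fun _ _ _ _ => c), (fun=> 0); split=> //.
  + exact: gradedC.
  + by move=> X; rewrite mulr0 addr0.
  + by move=> *; exists c%:P; rewrite hornerC; split=> // mu _; rewrite mul1r hornerC.
- case.
  + exists (fun _ _ _ _ => 0), (fun=> 1); split=> //.
    * exact: graded0.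
    * by move=> X; rewrite mulr1 add0r.
    * exact: gradedC.
    * move=> u1 u2 u3 u4.
      (* The all-ones matrix has rank 1 and the last row of [offset] is zero, so [L] is linear in
         [mu^-1] without constant term. *)
      exists ('X * (((u4 - u2) * (u3 - u2) - u1 * u2)%:P)); split; first by rewrite !hornerE.
      move=> mu mu0; rewrite !hornerE /L /a1 /a2 /a3 /b1 /b2 /b3 !mxE /=.
      by field.
  + exists (fun u1 _ _ _ => u1), (fun=> 0); split=> //.
    * exact: graded_gen (gen_v1 K).
    * by move=> X; rewrite mulr0 addr0.
    * exact: graded0.
    * move=> u1 u2 u3 u4; exists u1%:P; rewrite hornerC; split=> // mu mu0.
      by rewrite hornerC /v1 /a1 /b1 !mxE /=; field.
  + exists (fun _ u2 _ _ => u2), (fun=> 0); split=> //.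
    * exact: graded_gen (gen_v2 K).
    * by move=> X; rewrite mulr0 addr0.
    * exact: graded0.
    * move=> u1 u2 u3 u4; exists (u2 *: (1 - u1 *: 'X)).
      split=> [|mu mu0]; first by rewrite !hornerE; ring.
      by rewrite !hornerE /v2 /a2 /b1 !mxE /=; field.
  + exists (fun _ _ u3 _ => u3), (fun=> 0); split=> //.
    * exact: graded_gen (gen_v3 K).
    * by move=> X; rewrite mulr0 addr0.
    * exact: graded0.
    * move=> u1 u2 u3 u4; exists (u3%:P + (u2 * (u3 - u2)) *: 'X).
      split=> [|mu mu0]; first by rewrite !hornerE; ring.
      by rewrite !hornerE /v3 /b2 /a1 !mxE /=; field.
  + exists (fun _ _ _ u4 => u4), (fun=> 0); split=> //.
    * exact: graded_gen (gen_v4 K).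
    * by move=> X; rewrite mulr0 addr0.
    * exact: graded0.
    * move=> u1 u2 u3 u4; exists u4%:P; rewrite hornerC; split=> // mu mu0.
      by rewrite hornerC /v4 /b3 /a1 !mxE /=; field.
- exists (fun u1 u2 u3 u4 => c u1 u2 u3 u4 + c' u1 u2 u3 u4),
    (fun X => h X + h' X); split.
  + exact: gradedD.
  + by move=> X; rewrite fE fE'; ring.
  + case: e {Ac Ac' cu cu'} Ah Ah' => [->->|e]; last exact: gradedD.
    by apply/funext => X; rewrite addr0.
  + move=> u1 u2 u3 u4; have [q [q0 qE]] := cu u1 u2 u3 u4.
    have [q' [q'0 qE']] := cu' u1 u2 u3 u4.
    exists (q + q'); rewrite hornerD q0 q'0; split=> // mu mu0.
    by rewrite hornerD -qE // -qE' // mulrDr.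
- exists (fun u1 u2 u3 u4 => c u1 u2 u3 u4 * c' u1 u2 u3 u4),
    (fun X => h X * g X + c (v1 X) (v2 X) (v3 X) (v4 X) * h' X); split.
  + exact: gradedM.
  + by move=> X; rewrite fE fE'; ring.
  + case: e {cu} Af Ah Ac => [|e] Af Ah Ac; case: e' {cu' Ac'} Ag Ah' => [|e'] Ag Ah'.
    * by rewrite Ah Ah'; apply/funext => X; rewrite mul0r mulr0 addr0.
    * rewrite Ah; apply: graded_ext (gradedM Ac Ah') _ => X.
      by rewrite mul0r add0r.
    * rewrite Ah' addSn; apply: graded_ext (gradedM Ah Ag) _ => X.
      by rewrite mulr0 addr0.
    * rewrite addSn; apply: gradedD; first exact: gradedM.
      by rewrite addnS -addSn; apply: gradedM.
  + move=> u1 u2 u3 u4; have [q [q0 qE]] := cu u1 u2 u3 u4.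
    have [q' [q'0 qE']] := cu' u1 u2 u3 u4.
    exists (q * q'); rewrite hornerM q0 q'0; split=> // mu mu0.
    by rewrite hornerM -qE // -qE' // doubleD exprD; ring.
Qed.

(** A term [f b1 ^+ j] with [f] of degree [k - j] has a pole of order at most
    [2 (k - j) + 3 j = 2 k + j]. *)
Lemma escape_expansion J k g : expansion J k g -> forall u1 u2 u3 u4,
  exists q : {poly K}, forall mu, mu != 0 ->
    mu ^+ (k.*2 + J) * g (escape u1 u2 u3 u4 mu) = q.[mu].
Proof.
elim: J g => [|J IH] g.
  move=> /escape_graded[c [h [_ _ _ cu]]] u1 u2 u3 u4; rewrite addn0.
  by have [q [_ qE]] := cu u1 u2 u3 u4; exists q.
move=> [g' [f [e [Eg /escape_graded[c [h [_ _ _ cu]]] ek gE]]]] u1 u2 u3 u4.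
have [q qE] := IH _ Eg u1 u2 u3 u4; have [q' [_ qE']] := cu u1 u2 u3 u4.
exists ('X * q + q' * (1 - u1 *: 'X) ^+ J.+1) => mu mu0.
rewrite !hornerE -qE // -qE' // -(escape_b1 u1 u2 u3 u4) // gE.
rewrite [(mu ^+ 3 * _) ^+ _]exprMn exprAC -ek -!addnn !exprD !exprS; ring.
Qed.

Definition pole_bounded k g := forall u1 u2 u3 u4, exists q : {poly K},
  forall mu, mu != 0 -> mu ^+ k.*2 * g (escape u1 u2 u3 u4 mu) = q.[mu].

(* Along [escape], [b1] has a pole of order 3 and the forms of degree 1 have
   poles of order 2, with arbitrary leading coefficients except for [L], where
   it vanishes. *)
Lemma expansion_top J k g g' f e : pole_bounded k g -> expansion J k g' ->
  A e f -> (e + J.+1 = k)%N -> (forall X, g X = g' X + f X * b1 X ^+ J.+1) ->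
  exists2 h, forall X, f X = L X * h X & 
    if e is e'.+1 then A e' h else h = fun=> 0.
Proof.
move=> pg Eg /escape_graded[c [h [_ fE Ah cu]]] ek gE; exists h => // X.
suff c0 u1 u2 u3 u4 : c u1 u2 u3 u4 = 0 by rewrite fE c0 add0r.
have [q qE] := escape_expansion Eg u1 u2 u3 u4.
have [q' [<- qE']] := cu u1 u2 u3 u4.
have [s sE] := pg u1 u2 u3 u4.
(* Both sides are [mu ^+ (2 k + J + 1)] times [g]. At [mu = 0] only the leading coefficient of [f]
   survives on the right, and the left side is 0. *)
have : 'X^(J.+1) * s = 'X * q + q' * (1 - u1 *: 'X) ^+ J.+1.
  apply: (@poly_eq_infinite _ _ _ 'X) => [|mu]; first by rewrite polyX_eq0.
  rewrite hornerX => mu0.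
  rewrite !hornerE ?hornerXn -sE // -qE // -qE' // -(escape_b1 u1 u2 u3 u4) // gE.
  rewrite [(mu ^+ 3 * _) ^+ _]exprMn exprAC -ek -!addnn !exprD !exprS; ring.
move=> /(congr1 (fun p : {poly K} => p.[0])).
by rewrite !hornerE ?hornerXn subr0 expr1n mulr1 expr0n mul0r => <-.
Qed.

(** The top coefficient is a multiple [L h], and [L b1^2 = - M2 b1 - N3] lowers the degree. The
    substitution consumes [b1^2], so it stops at degree 1. *)
Lemma expansion_lower J k g : pole_bounded k g ->
  expansion J k g -> expansion (minn J 1) k g.
Proof.
move=> pg; elim: J => // -[//|J] IH Eg; rewrite minnSS minn0; rewrite minnSS minn0 in IH.
apply: IH; case: Eg => g' [f [e [Eg Af ek gE]]].
have {}Eg : expansion J.+1 k g' by [].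
have [h fE Ah] := expansion_top pg Eg Af ek gE.
case: e Af ek Ah => [|e] Af ek Ah.
  by apply: expansion_ext Eg _ => X; rewrite gE fE Ah mulr0 mul0r addr0.
have J1k : (J.+1 <= k)%N by lia.
have T1 : expansion J.+1 k (fun X => (-1 * (h X * M2 X)) * b1 X ^+ J.+1).
  apply: (expansion_term (gradedZ _ (gradedM Ah (M2_graded K)))).
    by rewrite -ek !addnS !addSn addn0.
  by rewrite leqnn.
have T0 : expansion J.+1 k (fun X => (-1 * (h X * N3 X)) * b1 X ^+ J).
  apply: (expansion_term (gradedZ _ (gradedM Ah (N3_graded K)))).
    by rewrite -ek !addnS !addSn addn0.
  by rewrite leqnSn.
apply: expansion_ext (expansionD Eg (expansionD T1 T0)) _ => X.
rewrite gE fE !exprS.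
have -> : L X * h X * (b1 X * (b1 X * b1 X ^+ J)) =
  h X * b1 X ^+ J * (L X * b1 X ^+ 2 + M2 X * b1 X + N3 X)
  - h X * M2 X * b1 X * b1 X ^+ J - h X * N3 X * b1 X ^+ J by ring.
by rewrite segre_relation; ring.
Qed.

(** In degree 1, [expansion_top] applies once more: the coefficient of [b1] is [L h], and [L b1] is
    the quadratic generator. *)
Lemma magic_coble k g : monomial_span (magic k) g -> pole_bounded k g ->
  graded (@coble_gen K) k g.
Proof.
move=> /magic_expansion Eg pg; have := expansion_lower pg Eg.
have AB e f : A e f -> graded (@coble_gen K) e f.
  elim=> {e f} *; [exact: graded0|exact: gradedC| |exact: gradedD|exact: gradedM].
  by apply: graded_gen; apply: gen_linear.
case: k Eg pg => [|k] Eg pg; first exact: AB.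
rewrite minnSS minn0 => -[g' [f [e [{}Eg Af ek gE]]]].
have [h fE Ah] := expansion_top (J := 0) pg Eg Af ek gE.
case: e Af ek Ah => [|e] Af ek Ah.
  by apply: graded_ext (AB _ _ Eg) _ => X; rewrite gE fE Ah mulr0 mul0r addr0.
have Ag : graded (@coble_gen K) k.+1 (fun X => h X * (L X * b1 X)).
  have -> : k.+1 = (e + 2)%N by lia.
  apply: gradedM (AB _ _ Ah) (graded_gen _).
  exact: gen_quadratic.
apply: graded_ext (gradedD (AB _ _ Eg) Ag) _ => X.
by rewrite gE fE expr1; ring.
Qed.

End PoleOrder.

(** * Sections of powers of the Pluecker bundle *)

Section Sections.
Variable R : realType.
Local Notation C := R[i].
Implicit Types (d k : nat) (s : cone R -> C) (U : 'M[C]_(6, 3)) (X : 'M[C]_3).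

Lemma cone_of_proof U : \rank U = 3%N ->
  `[< exists U' : 'M[C]_(6, 3), \rank U' = 3%N /\ wedge3 U = wedge3 U' >].
Proof. by move=> rU; apply/asboolP; exists U. Qed.

(* The base point of [cone] is a junk value, for matrices of rank less than 3. *)
Definition cone_of U : cone R :=
  if pselect (\rank U = 3%N) is left rU then exist _ (wedge3 U) (cone_of_proof rU)
  else point.

Lemma val_cone_of U : \rank U = 3%N -> val (cone_of U) = wedge3 U.
Proof. by rewrite /cone_of; case: pselect. Qed.

Lemma cone_val_inj (v w : cone R) : val v = val w -> v = w.
Proof. exact: val_inj. Qed.

Lemma cone_ofP (v : cone R) : exists2 U, \rank U = 3%N & v = cone_of U.
Proof.
case: v => x hx; have /asboolP[U [rU xE]] := hx; exists U => //.
by apply: cone_val_inj; rewrite val_cone_of.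
Qed.

Lemma homog_eval_scale n d (P : {mpoly C[n]}) (a : C) (x : 'I_n -> C) :
  P \is d.-homog -> P.@[fun i => a * x i] = a ^+ d * P.@[x].
Proof.
move=> /dhomogP hP; rewrite !mevalE mulr_sumr big_seq [RHS]big_seq.
apply: eq_bigr => m /hP /= md; rewrite mulrCA; congr (_ * _).
under eq_bigr do rewrite exprMn.
by rewrite big_split /= -expr_sum -mdegE md.
Qed.

Lemma section_scale d s (v w : cone R) (a : C) : plucker_section d s -> a != 0 ->
  (forall I, val w I = a * val v I) -> s w = a ^+ d * s v.
Proof.
move=> /(_ v)[e [P [Q [hP hQ Qv PQ]]]] a0 wv.
have evE n (F : {mpoly C[#|{: triple}|]}) : F \is n.-homog ->
    ext3_eval F (val w) = a ^+ n * ext3_eval F (val v).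
  by move=> hF; rewrite /ext3_eval -homog_eval_scale //; apply: meval_eq => i.
rewrite !PQ ?(evE _ _ hP) ?(evE _ _ hQ) ?mulf_neq0 ?expf_neq0 //.
by rewrite exprD; field; rewrite Qv expf_neq0.
Qed.

Lemma rank_mulmx_unit U (h : 'M[C]_3) : h \in unitmx ->
  \rank (U *m h) = \rank U.
Proof. by move=> hu; rewrite mxrankMfree // row_free_unit. Qed.

Lemma rank_unit_mulmx (g : 'M[C]_6) U : g \in unitmx ->
  \rank (g *m U) = \rank U.
Proof.
by move=> gu; rewrite -mxrank_tr trmx_mul mxrankMfree ?mxrank_tr // row_free_unit unitmx_tr.
Qed.

Lemma rank_left_inverse (V : 'M[C]_(3, 6)) U : V *m U = 1%:M -> \rank U = 3%N.
Proof.
move=> VU; apply/eqP; rewrite eqn_leq rank_leq_col /=.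
by rewrite -{1}(mxrank1 C 3) -VU mxrankM_maxr.
Qed.

Lemma section_mulmx d s U (h : 'M[C]_3) : plucker_section d s ->
  \rank U = 3%N -> h \in unitmx ->
  s (cone_of (U *m h)) = \det h ^+ d * s (cone_of U).
Proof.
move=> hs rU hu; apply: section_scale hs _ _; first by rewrite -unitfE -unitmxE.
move=> I; rewrite !val_cone_of ?rank_mulmx_unit // !ffunE.
by rewrite -mul_rowsub_mx det_mulmx mulrC.
Qed.

(** Pluecker coordinates are polynomials in the entries of a frame, so a section pulls back along
    any family of frames with entries in [A]. *)
Lemma section_locquot D (A : (D -> C) -> Prop) d s (U : D -> 'M[C]_(6, 3)) :
  funalg A -> (forall i j, A (fun x => U x i j)) -> plucker_section d s ->
  locquot A (fun x => \rank (U x) = 3%N) (fun x => s (cone_of (U x))).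
Proof.
move=> hA AU hs x0 rx0; have [e [P [Q [_ _ Q0 PQ]]]] := hs (cone_of (U x0)).
have AE (F : {mpoly C[#|{: triple}|]}) : A (fun x => ext3_eval F (wedge3 (U x))).
  apply: (funalg_meval hA) => i.
  apply: (funalg_ext (f := fun x => \det (rowsub (val (enum_val i)) (U x)))) => [|x].
    by apply: (funalg_det hA) => a b; apply: funalg_ext (AU _ b) _ => x; rewrite mxE.
  by rewrite ffunE.
exists (fun x => ext3_eval P (wedge3 (U x))), (fun x => ext3_eval Q (wedge3 (U x))).
split=> //; first by rewrite -val_cone_of.
by move=> x rx Qx; rewrite PQ val_cone_of.
Qed.

Lemma plucker_sectionD d s s' : plucker_section d s -> plucker_section d s' ->
  plucker_section d (s \+ s').
Proof.
move=> hs hs' v; have [e [P [Q [hP hQ Qv PQ]]]] := hs v.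
have [e' [P' [Q' [hP' hQ' Qv' PQ']]]] := hs' v.
exists (e + e')%N, (P * Q' + P' * Q), (Q * Q'); split.
- apply: dhomogD; last by rewrite [(e + e')%N]addnC addnAC; exact: dhomogM.
  by rewrite addnAC; exact: dhomogM.
- exact: dhomogM.
- by rewrite /ext3_eval mevalM mulf_neq0.
- move=> w; rewrite /ext3_eval mevalM mulf_eq0 negb_or => /andP[Qw Qw'].
  rewrite /= PQ // PQ' // /ext3_eval mevalD !mevalM.
  by rewrite -/(ext3_eval _ _) addf_div.
Qed.

Lemma plucker_sectionM d d' s s' : plucker_section d s -> plucker_section d' s' ->
  plucker_section (d + d') (s \* s').
Proof.
move=> hs hs' v; have [e [P [Q [hP hQ Qv PQ]]]] := hs v.
have [e' [P' [Q' [hP' hQ' Qv' PQ']]]] := hs' v.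
exists (e + e')%N, (P * P'), (Q * Q'); split.
- by rewrite addnACA; exact: dhomogM.
- exact: dhomogM.
- by rewrite /ext3_eval mevalM mulf_neq0.
- move=> w; rewrite /ext3_eval mevalM mulf_eq0 negb_or => /andP[Qw Qw'].
  by rewrite /= PQ // PQ' // /ext3_eval !mevalM mulf_div.
Qed.

Lemma plucker_section_cst (c : C) : plucker_section 0 (cst c : cone R -> C).
Proof.
move=> v; exists 0%N, c%:MP, 1; split.
- by rewrite -[X in X \is _]mulr1 mul_mpolyC; apply/dhomogZ/dhomog1.
- exact: dhomog1.
- by rewrite /ext3_eval meval1 oner_neq0.
- by move=> w _; rewrite /ext3_eval mevalC meval1 divr1.
Qed.

Lemma plucker_section0 d : plucker_section d (cst 0 : cone R -> C).
Proof.
move=> v; exists 0%N, 0, 1; split.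
- exact: dhomog0.
- exact: dhomog1.
- by rewrite /ext3_eval meval1 oner_neq0.
- by move=> w _; rewrite /ext3_eval meval0 mul0r.
Qed.

Lemma plucker_section_linear (c : triple -> C) :
  plucker_section 1 (fun v : cone R => \sum_(J : triple) c J * val v J).
Proof.
move=> v; exists 0%N, (\sum_(J : triple) c J *: 'X_(enum_rank J)), 1; split.
- apply: rpred_sum => J _; apply: dhomogZ; rewrite dhomogX; exact/eqP/mdeg1.
- exact: dhomog1.
- by rewrite /ext3_eval meval1 oner_neq0.
- move=> w _; rewrite /ext3_eval meval1 divr1 raddf_sum /=.
  by apply: eq_bigr => J _; rewrite mevalZ mevalXU enum_rankK.
Qed.

End Sections.

(** * The affine chart and paths to its boundary *)

Section Chart.
Variable R : realType.
Local Notation C := R[i].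
Implicit Types (d k : nat) (s : cone R -> C) (U : 'M[C]_(6, 3)) (X : 'M[C]_3).

Definition chart X : 'M[C]_(6, 3) := \matrix_(i, j)
  nth 0 [:: (j == 0)%:R; (j == 1)%:R; (j == 2%:R)%:R; X 0 j; X 1 j; X 2%:R j] i.

Definition idx (a b c : 'I_6) : 'I_3 -> 'I_6 := fun j => nth a [:: a; b; c] j.

Definition minor (a b c : 'I_6) U : C := \det (rowsub (idx a b c) U).

Definition diag_of (d : 'I_6 -> C) : 'M[C]_6 := diag_mx (\row_i d i).

Lemma sum_ord3 (V : nmodType) (F : 'I_3 -> V) : \sum_i F i = F 0 + F 1 + F 2%:R.
Proof.
rewrite !big_ord_recl big_ord0 addr0 addrA.
by congr (_ + F _ + F _); apply/val_inj.
Qed.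

Lemma det3 (M : 'M[C]_3) : \det M =
  M 0 0 * (M 1 1 * M 2%:R 2%:R - M 1 2%:R * M 2%:R 1)
  - M 0 1 * (M 1 0 * M 2%:R 2%:R - M 1 2%:R * M 2%:R 0)
  + M 0 2%:R * (M 1 0 * M 2%:R 1 - M 1 1 * M 2%:R 0).
Proof.
have o1 : lift 0 0 = 1 :> 'I_3 by apply/val_inj.
have o2 : lift 0 1 = 2%:R :> 'I_3 by apply/val_inj.
have l10 : lift 1 0 = 0 :> 'I_3 by apply/val_inj.
have l11 : lift 1 1 = 2%:R :> 'I_3 by apply/val_inj.
have l20 : lift 2%:R 0 = 0 :> 'I_3 by apply/val_inj.
have l21 : lift 2%:R 1 = 1 :> 'I_3 by apply/val_inj.
have o3 : lift 0 0 = 1 :> 'I_2 by apply/val_inj.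
have p0 : lift 1 0 = 0 :> 'I_2 by apply/val_inj.
have det2 (N : 'M[C]_2) : \det N = N 0 0 * N 1 1 - N 0 1 * N 1 0.
  rewrite (expand_det_row _ 0) !big_ord_recl big_ord0 addr0 /cofactor !det_mx11.
  by rewrite !mxE /= !o3 !p0 /= expr1 expr0; ring.
rewrite (expand_det_row _ 0) sum_ord3 /cofactor !det2 !mxE /=.
rewrite !(o1, o2, l10, l11, l20, l21) /=; ring.
Qed.

Lemma rank_chart X : \rank (chart X) = 3%N.
Proof.
apply: (@rank_left_inverse _ (\matrix_(i < 3, j < 6) (i == j :> nat)%:R)).
apply/matrixP => i j; rewrite !mxE !big_ord_recl big_ord0 !mxE /=.
by case: i => -[|[|[|//]]] ?; case: j => -[|[|[|//]]] ? /=; rewrite ?mxE /=; ring.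
Qed.

Lemma chart_decomposition U : minor 0 1 2%:R U != 0 ->
  exists X, U = chart X *m rowsub (idx 0 1 2%:R) U.
Proof.
move=> mU; set M := rowsub _ U.
have Mu : M \in unitmx by rewrite unitmxE unitfE.
exists (rowsub (idx 3%:R 4%:R 5%:R) U *m invmx M).
have XM i j : U (idx 3%:R 4%:R 5%:R i) j =
    \sum_k (rowsub (idx 3%:R 4%:R 5%:R) U *m invmx M) i k * M k j.
  have := mulmxKV Mu (rowsub (idx 3%:R 4%:R 5%:R) U) => /matrixP/(_ i j).
  by rewrite !mxE.
apply/matrixP => i j; rewrite [RHS]mxE.
under eq_bigr do rewrite mxE.
case: i => -[|[|[|[|[|[|//]]]]]] hi /=.
- rewrite sum_ord3 /= !mxE mul1r !mul0r !addr0; congr (U _ _); exact/val_inj.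
- rewrite sum_ord3 /= !mxE mul1r !mul0r add0r !addr0; congr (U _ _); exact/val_inj.
- rewrite sum_ord3 /= !mxE mul1r !mul0r !add0r; congr (U _ _); exact/val_inj.
- by rewrite -XM; congr (U _ _); exact/val_inj.
- by rewrite -XM; congr (U _ _); exact/val_inj.
- by rewrite -XM; congr (U _ _); exact/val_inj.
Qed.

Lemma chart_row_scale (a : 'I_3) (z : C) X :
  chart (\matrix_(i, j) (z ^+ (i == a) * X i j)) =
  diag_of (fun i => if i == (3 + a)%N :> nat then z else 1) *m chart X.
Proof.
apply/matrixP => i j; rewrite mul_diag_mx !mxE.
by case: a => -[|[|[|//]]] ?; case: i => -[|[|[|[|[|[|//]]]]]] ? /=;
  rewrite ?expr0 ?expr1 ?mul1r.
Qed.

(** Scaling column [a] by a change of frame also scales the identity block, which the diagonal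
    matrix with entry [z^-1] restores. *)
Lemma chart_col_scale (a : 'I_3) (z : C) X : z != 0 ->
  chart (\matrix_(i, j) (z ^+ (j == a) * X i j)) =
  diag_of (fun i => if i == a :> nat then z^-1 else 1) *m chart X *m
  diag_mx (\row_j (z ^+ (j == a))).
Proof.
move=> z0; apply/matrixP => i j; rewrite mul_mx_diag mul_diag_mx !mxE.
by case: a => -[|[|[|//]]] ?; case: i => -[|[|[|[|[|[|//]]]]]] ?;
  case: j => -[|[|[|//]]] ? /=;
  rewrite ?expr0 ?expr1 ?mul1r ?mulr1 ?mul0r ?mulr0 ?mulVf // mulrC.
Qed.

(* [escape_frame] has the same column space as [chart (escape mu)] for
   [mu != 0], and still has rank 3 at [mu = 0]. *)
Definition escape_cols (mu : C) : 'M[C]_3 := \matrix_(i, j)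
  if (i == 0) && (j == 0) || (i == 1) && (j == 1) then 1 else
  if (i == 1) && (j == 0) || (i == 2%:R) && (j == 1) then -1 else
  if (i == 2%:R) && (j == 2%:R) then mu else 0.

Definition escape_frame (u1 u2 u3 u4 mu : C) : 'M[C]_(6, 3) :=
  chart (offset u1 u2 u3 u4) *m escape_cols mu +
  \matrix_(i, j) ((2 < i)%N && (j == 2%:R))%:R.

Lemma det_escape_cols mu : \det (escape_cols mu) = mu.
Proof. by rewrite det3 !mxE /=; ring. Qed.

Lemma escape_frameE u1 u2 u3 u4 mu : mu != 0 ->
  escape_frame u1 u2 u3 u4 mu = chart (escape u1 u2 u3 u4 mu) *m escape_cols mu.
Proof.
move=> mu0; apply/matrixP => i j; rewrite !mxE !sum_ord3 !mxE.
case: i => -[|[|[|[|[|[|//]]]]]] ?; case: j => -[|[|[|//]]] ? /=;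
  rewrite ?mxE /=; by field.
Qed.

Lemma rank_escape_frame u1 u2 u3 u4 mu : \rank (escape_frame u1 u2 u3 u4 mu) = 3%N.
Proof.
have [mu0|mu0] := eqVneq mu 0; last first.
  rewrite escape_frameE // rank_mulmx_unit ?rank_chart //.
  by rewrite unitmxE det_escape_cols unitfE.
pose D := offset u1 u2 u3 u4.
(* At [mu = 0] the first two rows of [V] invert the first two columns of the upper block. The third
   uses the first row of the lower block, whose last entry is then 1. *)
pose V : 'M[C]_(3, 6) := \matrix_(i, j) nth 0 (nth [::]
  [:: [:: 1; 0; 0; 0; 0; 0]; [:: 1; 1; 0; 0; 0; 0];
      [:: - D 0 0; - D 0 1; - D 0 2%:R; 1; 0; 0]] i) j.
apply: (@rank_left_inverse _ V); apply/matrixP => i j.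
rewrite mxE !big_ord_recl big_ord0 !mxE !sum_ord3 !mxE /= mu0.
by case: i => -[|[|[|//]]] ?; case: j => -[|[|[|//]]] ? /=; ring.
Qed.

End Chart.

(** * Invariant sections for a conjugate of the diagonal torus *)

Section DiagonalTorus.
Variables (R : realType) (g : 'M[R[i]]_6).
Hypothesis gu : g \in unitmx.
Local Notation C := R[i].
Implicit Types (d k e : nat) (s : cone R -> C) (U : 'M[C]_(6, 3)) (X : 'M[C]_3).

Definition conj_torus : set (SL6 R) :=
  fun t => is_diag_mx (invmx g *m val t *m g).

Local Notation T := conj_torus.
Local Notation gens := (fun F : {poly (cone R -> C)} =>
  exists2 k : nat, (k <= 2)%N & homogeneous_element T k F).

(** In the basis given by [g], the torus acts on frames by diagonal matrices. *)
Definition frame s U : C := s (cone_of (g *m U)).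

Lemma cone_frameP (v : cone R) : exists2 U, \rank U = 3%N & v = cone_of (g *m U).
Proof.
have [U rU ->] := cone_ofP v; exists (invmx g *m U); last by rewrite mulKVmx.
by rewrite rank_unit_mulmx ?unitmx_inv.
Qed.

Lemma cone_act_of (t : SL6 R) U : \rank U = 3%N ->
  cone_act t (cone_of U) = cone_of (val t *m U).
Proof.
move=> rU; apply: cone_val_inj; rewrite /= [val (cone_of U)]val_cone_of //.
rewrite ext3_act_wedge3 val_cone_of // rank_unit_mulmx //.
by rewrite unitmxE (eqP (valP t)) unitr1.
Qed.

Lemma frame_mulmx d s U (h : 'M[C]_3) : plucker_section d s ->
  \rank U = 3%N -> h \in unitmx -> frame s (U *m h) = \det h ^+ d * frame s U.
Proof.
by move=> hs rU hu; rewrite /frame mulmxA (section_mulmx hs) ?rank_unit_mulmx.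
Qed.

Lemma rank_diag_mulmx (d : 'I_6 -> C) U : (forall i, d i != 0) ->
  \rank (diag_of d *m U) = \rank U.
Proof.
move=> d0; apply: rank_unit_mulmx; rewrite unitmxE det_diag unitfE.
by apply/prodf_neq0 => i _; rewrite mxE.
Qed.

Lemma frame_diag1 d s U (c : 'I_6 -> C) : invariant_section T d s ->
  \prod_i c i = 1 -> \rank U = 3%N -> frame s (diag_of c *m U) = frame s U.
Proof.
move=> [_ hs] c1 rU.
have dt : \det (g *m diag_of c *m invmx g) == 1.
  rewrite !det_mulmx mulrAC -det_mulmx mulmxV // det1 mul1r det_diag.
  by apply/eqP; rewrite -[RHS]c1; apply: eq_bigr => i _; rewrite mxE.
pose t : SL6 R := exist (fun h : 'M[C]_6 => \det h == 1) _ dt.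
have Tt : T t.
  by rewrite /conj_torus /= !mulmxA mulVmx // mul1mx mulmxKV // diag_mx_is_diag.
have := hs t Tt (cone_of (g *m U)).
by rewrite cone_act_of ?rank_unit_mulmx // !mulmxA mulmxKV // -mulmxA.
Qed.

(* Rescaling [c] by a sixth root of its product brings it into SL_6. *)
Lemma frame_diag k s U (c : 'I_6 -> C) : invariant_section T (2 * k) s ->
  (forall i, c i != 0) -> \rank U = 3%N ->
  frame s (diag_of c *m U) = (\prod_i c i) ^+ k * frame s U.
Proof.
move=> hs c0 rU; set p := \prod_i c i.
have p0 : p != 0 by apply/prodf_neq0.
pose z := 6.-root p; have z6 : z ^+ 6 = p by apply: rootCK.
have z0 : z != 0 by apply: contraNneq p0 => z0; rewrite -z6 z0 expr0n.
pose c' i := c i / z.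
have c'1 : \prod_i c' i = 1.
  by rewrite big_split /= prodr_const card_ord exprVn z6 divff.
have -> : diag_of c *m U = diag_of c' *m U *m z%:M.
  apply/matrixP => i j; rewrite mul_mx_scalar !mul_diag_mx !mxE /c'.
  by field.
have c'0 i : c' i != 0 by rewrite mulf_neq0 ?invr_eq0.
rewrite (frame_mulmx hs.1) ?rank_diag_mulmx //; last first.
  by rewrite unitmxE det_scalar unitfE expf_neq0.
by rewrite (frame_diag1 hs) // det_scalar -exprM mulnA exprM z6.
Qed.

(** A minor in the coordinates adapted to [g], expanded by Cauchy-Binet as a linear form in the
    Pluecker coordinates. *)
Definition minor_section (a b c : 'I_6) (v : cone R) : C :=
  \sum_(J : triple) \det (mxsub (idx a b c) (val J) (invmx g)) * val v J.

Lemma minor_sectionE a b c U : \rank U = 3%N ->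
  frame (minor_section a b c) U = minor a b c U.
Proof.
move=> rU; rewrite /frame /minor_section val_cone_of ?rank_unit_mulmx //.
rewrite /minor -{2}(mulKmx gu U) -mul_rowsub_mx Cauchy_Binet.
apply: eq_bigr => J _; rewrite ffunE; congr (\det _ * _).
by apply/matrixP => i j; rewrite !mxE.
Qed.

Lemma minor_diag a b c (d : 'I_6 -> C) U :
  minor a b c (diag_of d *m U) = d a * d b * d c * minor a b c U.
Proof.
rewrite /minor !det3; rewrite !mul_diag_mx !mxE /idx /=; ring.
Qed.

Lemma conj_torusP (t : SL6 R) : T t ->
  exists2 d : 'I_6 -> C, \prod_i d i = 1 & val t = g *m diag_of d *m invmx g.
Proof.
move=> /is_diag_mxP hT; set D := invmx g *m val t *m g in hT.
have DE : D = diag_of (fun i => D i i).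
  apply/matrixP => i j; rewrite [RHS]mxE [X in X *+ _]mxE.
  have [->|ij] := eqVneq i j; first by rewrite mulr1n.
  by rewrite mulr0n hT.
exists (fun i => D i i); last by rewrite -DE !mulmxA mulmxV // mul1mx mulmxK.
transitivity (\det D).
  by rewrite [in RHS]DE det_diag; apply: eq_bigr => i _; rewrite [RHS]mxE.
by rewrite !det_mulmx mulrAC -det_mulmx mulVmx // det1 mul1r (eqP (valP t)).
Qed.

Lemma frame_cone_act (t : SL6 R) : T t -> exists2 d : 'I_6 -> C, \prod_i d i = 1 &
  forall U, \rank U = 3%N ->
    \rank (diag_of d *m U) = 3%N /\
    cone_act t (cone_of (g *m U)) = cone_of (g *m (diag_of d *m U)).
Proof.
move=> /conj_torusP[d d1 tE]; exists d => // U rU; split.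
  rewrite rank_diag_mulmx // => i; apply: contra_eq_neq d1 => di.
  by rewrite (bigD1 i) //= di mul0r eq_sym oner_neq0.
rewrite cone_act_of ?rank_unit_mulmx // tE; congr cone_of.
by rewrite !mulmxA mulmxKV.
Qed.

Lemma minor_plucker_section a b c : plucker_section 1 (minor_section a b c).
Proof. exact: plucker_section_linear. Qed.

Lemma minor_section_act a b c (t : SL6 R) (d : 'I_6 -> C) U : \rank U = 3%N ->
  \rank (diag_of d *m U) = 3%N ->
  cone_act t (cone_of (g *m U)) = cone_of (g *m (diag_of d *m U)) ->
  minor_section a b c (cone_act t (cone_of (g *m U))) =
  d a * d b * d c * minor_section a b c (cone_of (g *m U)).
Proof.
move=> rU rdU ->; rewrite -/(frame _ _) minor_sectionE // minor_diag.
by rewrite -[X in _ * minor_section _ _ _ X]/(cone_of _) -/(frame _ U) minor_sectionE.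
Qed.

Lemma generated_subalgebra : is_subalgebra (generated_algebra gens).
Proof.
split=> [c B [[hC _ _] _]|F G hF hG B hB|F G hF hG B hB]; first exact: hC.
- by have [[_ hD _] _] := hB; apply: hD; [apply: hF|apply: hG].
- by have [[_ _ hM] _] := hB; apply: hM; [apply: hF|apply: hG].
Qed.

Lemma generated_homogeneous e s : (e <= 2)%N -> invariant_section T (2 * e) s ->
  generated_algebra gens (s%:P * 'X^e).
Proof. by move=> e2 hs B [_ hB]; apply: hB; exists e => //; exists s. Qed.

Lemma invariant_sectionD d s s' : invariant_section T d s ->
  invariant_section T d s' -> invariant_section T d (s \+ s').
Proof.
move=> [hs is_] [hs' is']; split; first exact: plucker_sectionD.
by move=> t Tt v /=; rewrite is_ // is'.
Qed.

Lemma invariant_sectionM d d' s s' : invariant_section T d s ->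
  invariant_section T d' s' -> invariant_section T (d + d') (s \* s').
Proof.
move=> [hs is_] [hs' is']; split; first exact: plucker_sectionM.
by move=> t Tt v /=; rewrite is_ // is'.
Qed.

Definition liftable e (f : 'M[C]_3 -> C) := exists s,
  [/\ invariant_section T (2 * e) s, forall X, frame s (chart X) = f X &
      generated_algebra gens (s%:P * 'X^e)].

Lemma liftable_small e s f : (e <= 2)%N -> invariant_section T (2 * e) s ->
  (forall X, frame s (chart X) = f X) -> liftable e f.
Proof. by move=> e2 hs sf; exists s; split=> //; apply: generated_homogeneous. Qed.

Lemma prod6 (d : 'I_6 -> C) :
  \prod_i d i = d 0 * d 1 * d 2%:R * d 3%:R * d 4%:R * d 5%:R.
Proof.
rewrite !big_ord_recl big_ord0 mulr1 !mulrA.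
by congr (_ * d _ * d _ * d _ * d _ * d _); apply/val_inj.
Qed.

(** Complementary minors together have weight [\prod_i d i], which is 1 on the torus. *)
Lemma minor2_liftable a b c a' b' c' f :
  (forall d : 'I_6 -> C, \prod_i d i = (d a * d b * d c) * (d a' * d b' * d c')) ->
  (forall X, minor a b c (chart X) * minor a' b' c' (chart X) = f X) ->
  liftable 1 f.
Proof.
move=> hd hf; apply: (@liftable_small _ (minor_section a b c \* minor_section a' b' c')).
- by [].
- split; first exact: plucker_sectionM (minor_plucker_section _ _ _)
    (minor_plucker_section _ _ _).
  move=> t /frame_cone_act[d d1 hU] v; have [U rU ->] := cone_frameP v.
  have [rdU tU] := hU _ rU; rewrite /= !(minor_section_act _ _ _ rU rdU tU).
  by rewrite mulrACA -hd d1 mul1r.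
- by move=> X; rewrite -hf -!(minor_sectionE _ _ _ (rank_chart X)).
Qed.

Lemma coble_gen_liftable e f : coble_gen e f -> liftable e f.
Proof.
case=> {e f} [_ _ []|].
- apply: (@minor2_liftable 0 1 2%:R 3%:R 4%:R 5%:R) => [d|X].
    by rewrite prod6; ring.
  rewrite /minor !det3 !mxE /= ?mxE /=.
  by rewrite /L /a1 /a2 /a3 /b1 /b2 /b3; ring.
(* For [v1, .., v4]: an entry of [X] times its complementary 2 x 2 minor, the order of the rows
   fixing the sign. *)
- apply: (@minor2_liftable 3%:R 1 2%:R 0 4%:R 5%:R) => [d|X].
    by rewrite prod6; ring.
  rewrite /minor !det3 !mxE /= ?mxE /=.
  by rewrite /v1 /a1 /b1; ring.
- apply: (@minor2_liftable 0 1 4%:R 2%:R 5%:R 3%:R) => [d|X].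
    by rewrite prod6; ring.
  rewrite /minor !det3 !mxE /= ?mxE /=.
  by rewrite /v2 /a2 /b1; ring.
- apply: (@minor2_liftable 0 1 5%:R 2%:R 4%:R 3%:R) => [d|X].
    by rewrite prod6; ring.
  rewrite /minor !det3 !mxE /= ?mxE /=.
  by rewrite /v3 /b2 /a1; ring.
- apply: (@minor2_liftable 0 4%:R 2%:R 5%:R 1 3%:R) => [d|X].
    by rewrite prod6; ring.
  rewrite /minor !det3 !mxE /= ?mxE /=.
  by rewrite /v4 /b3 /a1; ring.
pose m := minor_section.
(* On the chart the four minors are [L], [X 0 0], [X 1 2] and [X 2 1]. Each row index occurs twice,
   so the weight is the square of [\prod_i d i]. *)
pose s := (m 3%:R 4%:R 5%:R \* m 3%:R 1 2%:R) \* (m 0 1 4%:R \* m 0 5%:R 2%:R).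
apply: (@liftable_small _ s).
- by [].
- have pm := minor_plucker_section; split.
    by apply: (@plucker_sectionM _ 2 2); apply: (@plucker_sectionM _ 1 1).
  move=> t /frame_cone_act[d d1 hU] v; have [U rU ->] := cone_frameP v.
  have [rdU tU] := hU _ rU.
  rewrite /s /m /= !(minor_section_act _ _ _ rU rdU tU).
  have AC (x y z w x' y' z' w' : C) : x * x' * (y * y') * (z * z' * (w * w')) =
      x * y * (z * w) * (x' * y' * (z' * w')) by ring.
  rewrite AC; apply: etrans (mul1r _); congr (_ * _).
  by rewrite -[RHS](expr1n _ 2) -d1 prod6; ring.
- move=> X; transitivity (minor 3%:R 4%:R 5%:R (chart X) *
    minor 3%:R 1 2%:R (chart X) *
    (minor 0 1 4%:R (chart X) * minor 0 5%:R 2%:R (chart X))).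
    by rewrite -!(minor_sectionE _ _ _ (rank_chart X)).
  rewrite /minor !det3 !mxE /= ?mxE /=.
  by rewrite /L /a1 /a2 /a3 /b1 /b2 /b3; ring.
Qed.

Lemma coble_liftable e f : graded (@coble_gen C) e f -> liftable e f.
Proof.
have [gC gD gM] := generated_subalgebra.
elim=> {e f} [e|c|e f|e f h _ [s [hs sf gs]] _ [s' [hs' sf' gs']]|
  e e' f h _ [s [hs sf gs]] _ [s' [hs' sf' gs']]].
- exists (cst 0); split=> //; first by split; [exact: plucker_section0|].
  have -> : (cst 0 : cone R -> C)%:P * 'X^e = (cst 0)%:P by rewrite mul0r.
  exact: gC.
- exists (cst c); split=> //; first by split; [exact: plucker_section_cst|].
  by rewrite mulr1; apply: gC.
- exact: coble_gen_liftable.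
- exists (s \+ s'); split; first exact: invariant_sectionD.
    by move=> X; rewrite -sf -sf'.
  have -> : (s \+ s')%:P * 'X^e = s%:P * 'X^e + s'%:P * 'X^e.
    by rewrite -mulrDl -polyCD.
  exact: gD.
- exists (s \* s'); split.
  + by rewrite mulnDr; apply: invariant_sectionM.
  + by move=> X; rewrite -sf -sf'.
  have -> : (s \* s')%:P * 'X^(e + e') = (s%:P * 'X^e) * (s'%:P * 'X^e').
    by rewrite exprD mulrACA -polyCM.
  exact: gM.
Qed.

End DiagonalTorus.

(** * From the chart to the coordinate ring *)

Section CoordinateRing.
Variables (R : realType) (g : 'M[R[i]]_6).
Hypothesis gu : g \in unitmx.
Local Notation C := R[i].
Implicit Types (d k : nat) (s : cone R -> C) (U : 'M[C]_(6, 3)) (X : 'M[C]_3).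
Local Notation T := (conj_torus g).
Local Notation gens := (fun F : {poly (cone R -> C)} =>
  exists2 k : nat, (k <= 2)%N & homogeneous_element T k F).

Lemma frame_locquot D (A : (D -> C) -> Prop) d s (U : D -> 'M[C]_(6, 3)) :
  funalg A -> (forall i j, A (fun x => U x i j)) -> plucker_section d s ->
  locquot A (fun x => \rank (U x) = 3%N) (fun x => frame g s (U x)).
Proof.
move=> hA AU hs; have := @section_locquot _ _ A d s (fun x => g *m U x) hA.
move=> /(_ _ hs) h; apply: (locquot_comp (u := id)) (h _) => // [x rx|].
  by rewrite rank_unit_mulmx.
by apply: (funalg_mulmx hA) => // i j; exact: (funalgC hA).
Qed.

Lemma section_chart_eq d s s' : plucker_section d s -> plucker_section d s' ->
  (forall X, frame g s (chart X) = frame g s' (chart X)) -> s = s'.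
Proof.
move=> hs hs' ss'; apply/funext => v; have [U rU ->] := cone_frameP gu v.
(* Being polynomial along every line is enough for [line_domain], hence for the density of the
   frames with nonzero [minor 0 1 2]. *)
pose A (f : 'M[C]_(6, 3) -> C) := forall a b, polyfun1 (fun t => f (a + t *: b)).
have hA : funalg A.
  split=> [c|f f' Af Af'|f f' Af Af'] a b.
  - exact: (funalgC (polyfun1_alg C)).
  - exact: (funalgD (polyfun1_alg C)).
  - exact: (funalgM (polyfun1_alg C)).
have Ae i j : A (fun U => U i j).
  move=> a b; exists ((a i j)%:P + 'X * (b i j)%:P) => t.
  by rewrite !mxE !hornerE.
apply: (@locquot_dense _ _ A (fun U => \rank U = 3%N) (frame g s) (frame g s')
  (minor 0 1 2%:R) (chart 0)) => //.
- by apply: line_domain => f a b; apply.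
- exact: (@frame_locquot _ A d s id).
- exact: (@frame_locquot _ A d s' id).
- apply: (funalg_det hA) => i j; apply: funalg_ext (Ae _ j) _ => U'.
  by rewrite mxE.
- move=> U' mU; have [X ->] := chart_decomposition mU.
  by rewrite rank_mulmx_unit ?rank_chart // unitmxE unitfE.
- rewrite /minor; set M := rowsub _ _; have -> : M = 1%:M; last by rewrite det1 oner_neq0.
  apply/matrixP => i j; rewrite !mxE.
  by case: i => -[|[|[|//]]] ?; case: j => -[|[|[|//]]] ?.
- move=> U' mU; have [X ->] := chart_decomposition mU.
  have hu : rowsub (idx 0 1 2%:R) U' \in unitmx by rewrite unitmxE unitfE.
  by rewrite (frame_mulmx gu hs) ?(frame_mulmx gu hs') ?rank_chart // ss'.
Qed.

Lemma chart_polyfun i j : polyfun (fun v : 'I_(3 * 3) -> C =>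
  chart (vec_mx (\row_i v i)) i j).
Proof.
have hv a b : polyfun (fun v : 'I_(3 * 3) -> C => vec_mx (\row_i v i) a b).
  by apply: funalg_ext (polyfun_var _ (mxvec_index a b)) _ => v; rewrite !mxE.
have hc (c : C) : polyfun (fun v : 'I_(3 * 3) -> C => c).
  exact: funalgC (polyfun_alg _ _) c.
apply: (funalg_ext (f := fun v : 'I_(3 * 3) -> C => nth 0 [:: (j == 0)%:R;
  (j == 1)%:R; (j == 2%:R)%:R; vec_mx (\row_i v i) 0 j;
  vec_mx (\row_i v i) 1 j; vec_mx (\row_i v i) 2%:R j] i)) => [|v]; last by rewrite [RHS]mxE.
by case: i => -[|[|[|[|[|[|//]]]]]] ? /=; first [exact: hc | exact: hv].
Qed.

(** Scaling a row of [X] is a diagonal action of weight [k]. For a column, the diagonal matrix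
    contributes [z^-k] and the change of frame [z^(2k)], again [z^k] in total. *)
Lemma frame_chart_span k s : invariant_section T (2 * k) s ->
  monomial_span (magic k) (fun X => frame g s (chart X)).
Proof.
move=> hs; apply: monomial_span_magic.
- move=> a z X z0; rewrite chart_row_scale (frame_diag gu hs) ?rank_chart //.
    by rewrite -big_mkcond /= (big_pred1 (rshift 3 a)).
  by move=> i; case: ifP => // _; exact: oner_neq0.
- move=> a z X z0; rewrite chart_col_scale //.
  have h0 : \prod_j (\row_j z ^+ (j == a)) 0 j = z.
    under eq_bigr do rewrite mxE.
    rewrite (bigD1 a) //= eqxx expr1 big1 ?mulr1 // => j ja.
    by rewrite (negPf ja).
  have d0 (i : 'I_6) : (if i == a :> nat then z^-1 else 1) != 0.
    by case: ifP => _; rewrite ?invr_eq0 ?oner_neq0.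
  rewrite (frame_mulmx gu hs.1) ?rank_diag_mulmx ?rank_chart //; last first.
    by rewrite unitmxE det_diag h0 unitfE.
  rewrite det_diag h0 (frame_diag gu hs) ?rank_chart //.
  rewrite -big_mkcond /= (big_pred1 (lshift 3 a)) //.
  rewrite mulrA; congr (_ * _).
  by rewrite mul2n -addnn exprD -mulrA -exprMn mulfV // expr1n mulr1.
- apply: polyfun_monomial_span; apply: regular_affine.
  apply: (locquot_comp (u := id)) (frame_locquot (polyfun_alg _ _) chart_polyfun hs.1) => // v _.
  exact: rank_chart.
Qed.

(** As [escape_frame] keeps rank 3 at [mu = 0], the section is regular, hence polynomial, along it;
    passing to the chart costs [\det (escape_cols mu) ^+ (2 * k)], that is [mu ^+ (2 * k)]. *)
Lemma frame_chart_pole k s : invariant_section T (2 * k) s ->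
  pole_bounded k (fun X => frame g s (chart X)).
Proof.
move=> hs u1 u2 u3 u4.
have [|q qE] := @regular_line _ (fun mu => frame g s (escape_frame u1 u2 u3 u4 mu)).
  apply: (locquot_comp (u := id)) (frame_locquot (polyfun1_alg _)
    (U := escape_frame u1 u2 u3 u4) _ hs.1) => // [mu _|i j].
    exact: rank_escape_frame.
  have hc (c : C) : polyfun1 (fun=> c) by exact: funalgC (polyfun1_alg _) c.
  apply: (funalg_ext (f := fun mu => (chart (offset u1 u2 u3 u4) *m escape_cols mu) i j +
    ((2 < i)%N && (j == 2%:R))%:R)) => [|mu]; last first.
    by rewrite [RHS]mxE; congr (_ + _); rewrite mxE.
  apply: (funalgD (polyfun1_alg _)) => //.
  apply: (funalg_mulmx (polyfun1_alg _)) => // {}i {}j.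
  apply: (funalg_ext (f := fun mu => if (i == 0) && (j == 0) || (i == 1) && (j == 1) then 1 else
    if (i == 1) && (j == 0) || (i == 2%:R) && (j == 1) then -1 else
    if (i == 2%:R) && (j == 2%:R) then mu else 0)) => [|mu]; last by rewrite mxE.
  case: (_ || _); first exact: hc.
  case: (_ || _); first exact: hc.
  by case: (_ && _); [exact: polyfun1_id | exact: hc].
exists q => mu mu0; rewrite -qE escape_frameE // (frame_mulmx gu hs.1) ?rank_chart //.
  by rewrite det_escape_cols mul2n.
by rewrite unitmxE det_escape_cols unitfE.
Qed.

Lemma generated_subset : (generated_algebra gens `<=` coordinate_ring T)%classic.
Proof.
apply: smallest_sub => [|F [k _ [s hs <-]] j]; last first.
  rewrite coefMXn coefC; case: ltngtP => [_|jk|->].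
  - by split; [exact: plucker_section0|].
  - by rewrite subn_eq0 leqNgt jk; split; [exact: plucker_section0|].
  - by rewrite subnn.
have h0 d : invariant_section T d (cst 0) by split; [exact: plucker_section0|].
split=> [c k|F G hF hG k|F G hF hG k].
- rewrite coefC; case: k => [|k] /=; last exact: h0.
  by split; [exact: plucker_section_cst|].
- by rewrite coefD; apply: invariant_sectionD.
- rewrite coefM; apply: (big_ind (invariant_section T (2 * k))).
  + exact: h0.
  + by move=> s s'; apply: invariant_sectionD.
  + move=> j _; have -> : (2 * k = 2 * j + 2 * (k - j))%N.
      by rewrite -mulnDr subnKC // -ltnS.
    exact: invariant_sectionM.
Qed.

Lemma coordinate_ring_conj_torus : coordinate_ring T = generated_algebra gens.
Proof.
apply/seteqP; split; last exact: generated_subset.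
move=> F hF; have [gC gD gM] := generated_subalgebra g.
rewrite -[F]coefK poly_def.
apply: (big_ind (generated_algebra gens)) => [|G H|k _]; first exact: (gC 0).
  exact: gD.
have hs := hF k.
have [s' [hs' sE gs']] := coble_liftable gu
  (magic_coble (frame_chart_span hs) (frame_chart_pole hs)).
by rewrite -mul_polyC (section_chart_eq hs.1 hs'.1).
Qed.

End CoordinateRing.

(** * Simultaneous diagonalization of a torus *)

Section MaximalTorus.
Variable R : realType.
Local Notation C := R[i].

(** Uniqueness of base [w] digits; it lets a single point separate all monomials with exponents
    below [w]. *)
Lemma digits_inj w r (m m' : 'I_r -> nat) :
  (forall i, m i < w)%N -> (forall i, m' i < w)%N ->
  (\sum_i m i * w ^ i = \sum_i m' i * w ^ i)%N -> m =1 m'.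
Proof.
elim: r m m' => [|r IH] m m' hm hm' e; first by case.
have w0 : (0 < w)%N by apply: leq_ltn_trans (hm ord0).
have E (n : 'I_r.+1 -> nat) : (\sum_i n i * w ^ i = n ord0 +
    (\sum_(i < r) n (lift ord0 i) * w ^ i) * w)%N.
  rewrite big_ord_recl expn0 muln1; congr (_ + _)%N.
  by rewrite big_distrl; apply: eq_bigr => i _ /=; rewrite /bump add1n expnSr mulnA.
rewrite !E in e.
have e0 : m ord0 = m' ord0.
  have := congr1 (fun n => n %% w)%N e.
  by rewrite !(addnC (_ ord0)) !modnMDl !modn_small.
have eS : (\sum_(i < r) m (lift ord0 i) * w ^ i =
    \sum_(i < r) m' (lift ord0 i) * w ^ i)%N.
  by apply/eqP; rewrite -(eqn_pmul2r w0) -(eqn_add2l (m ord0)) {2}e0 e.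
move=> i; case: (unliftP ord0 i) => [j|] ->; last exact: e0.
exact: (IH (fun i => m (lift ord0 i)) (fun i => m' (lift ord0 i))).
Qed.

(* The powers of [M] are the values of one exponential sum with distinct bases
   [a m], so [M] is diagonalizable and the matrices [B m] are polynomials in it. *)
Lemma exponential_sum_diag n (I : finType) (M : 'M[C]_n.+1) (a : I -> C)
    (B : I -> 'M[C]_n.+1) : injective a ->
  (forall j, M ^+ j = \sum_m a m ^+ j *: B m) ->
  exists2 g, g \in unitmx & forall m, is_diag_mx (invmx g *m B m *m g).
Proof.
move=> a_inj MB.
have hM q : horner_mx M q = \sum_m q.[a m] *: B m.
  rewrite -{1}[q]coefK poly_def rmorph_sum /=.
  under eq_bigr => j _ do rewrite linearZ /= rmorphXn /= horner_mx_X MB scaler_sumr.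
  rewrite exchange_big /=; apply: eq_bigr => m _.
  rewrite horner_coef scaler_suml; apply: eq_bigr => j _.
  by rewrite scalerA.
have : diagonalizable M.
  apply/diagonalizableP; exists [seq a m | m : I].
    by rewrite map_inj_uniq ?enum_uniq.
  apply: mxminpoly_min; rewrite hM big1 // => m _.
  suff -> : (\prod_(x <- [seq a m0 | m0 : I]) ('X - x%:P)).[a m] = 0.
    by rewrite scale0r.
  by apply/eqP; rewrite -rootE root_prod_XsubC codom_f.
move=> [P Pu /(diagonalizable_forLR Pu)[D ME]].
exists (invmx P); first by rewrite unitmx_inv.
move=> m.
(* Divided by its value at [a m], this is the Lagrange polynomial that extracts [B m] from the
   exponential sum. *)
pose q := \prod_(m' | m' != m) ('X - (a m')%:P) : {poly C}.
have qm : q.[a m] != 0.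
  rewrite horner_prod; apply/prodf_neq0 => m' mm'.
  by rewrite !hornerE subr_eq0 (inj_eq a_inj) eq_sym.
have -> : B m = horner_mx M ((q.[a m])^-1 *: q).
  rewrite hM (bigD1 m) //= big1 ?addr0 => [|m' mm'].
    by rewrite hornerZ mulVf // scale1r.
  have -> : (q.[a m]^-1 *: q).[a m'] = 0; last by rewrite scale0r.
  rewrite hornerZ [X in _ * X]horner_prod [X in _ * X](bigD1 m') //=.
  by rewrite hornerXsubC subrr mul0r mulr0.
rewrite invmxK -horner_mx_uconj //.
rewrite ME mxpoly.conjumx ?unitmx_inv // invmxK !mulmxA mulmxV // mul1mx mulmxK //.
by rewrite horner_mx_diag diag_mx_is_diag.
Qed.

Lemma torus_matrix_form r (f : 'I_6 -> 'I_6 -> ('I_r -> C) -> C) :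
  (forall i j, regular_on_Gm (f i j)) -> exists N (P : 'I_6 -> 'I_6 -> {mpoly C[r]}),
  forall i j t, Gm t -> f i j t = (P i j).@[t] / (\prod_k t k) ^+ N.
Proof.
move=> hf.
have /choice[PN hPN] : forall ij : 'I_6 * 'I_6, exists pN : {mpoly C[r]} * nat,
    forall t, Gm t -> f ij.1 ij.2 t = pN.1.@[t] / (\prod_k t k) ^+ pN.2.
  by move=> [i j]; have [p [N pN]] := hf i j; exists (p, N).
exists (\max_ij (PN ij).2)%N, (fun i j => (PN (i, j)).1 *
  (\prod_k 'X_k) ^+ (\max_ij (PN ij).2 - (PN (i, j)).2)) => i j t tG.
rewrite (hPN (i, j)) // mevalM rmorphXn /= rmorph_prod /=.
under [in RHS]eq_bigr do rewrite mevalXU.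
have p0 : \prod_k t k != 0 by apply/prodf_neq0 => k _; apply: tG.
have hle : ((PN (i, j)).2 <= \max_ij (PN ij).2)%N.
  exact: (leq_bigmax (F := fun ij => (PN ij).2)).
set K := (\max_ij _)%N in hle *; set n := (PN (i, j)).2 in hle *.
have -> : (\prod_k t k) ^+ K = (\prod_k t k) ^+ (K - n) * (\prod_k t k) ^+ n.
  by rewrite -exprD subnK.
by rewrite invfM mulrA mulfK ?expf_neq0.
Qed.

Lemma torus_sub_conj (T : set (SL6 R)) : is_torus T ->
  exists2 g, g \in unitmx & (T `<=` conj_torus g)%classic.
Proof.
move=> [_ [r [phi [psi [phiT phiM phiR _]]]]].
have [N [P PE]] := torus_matrix_form phiR.
pose w := (\max_(ij : 'I_6 * 'I_6) msize (P ij.1 ij.2)).+1.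
pose B (m : 'X_{1..r < w}) : 'M[C]_6 := \matrix_(i, j) (P i j)@_m.
pose mono (t : 'I_r -> C) (m : 'X_{1..r < w}) := \prod_k t k ^+ m k.
have phiE t : Gm t -> val (phi t) =
    \sum_m ((\prod_k t k) ^+ N)^-1 * mono t m *: B m.
  move=> tG; apply/matrixP => i j; rewrite PE // summxE.
  have lw : (msize (P i j) <= w)%N.
    by apply/leqW/(leq_bigmax (F := fun ij => msize (P ij.1 ij.2)) (i, j)).
  rewrite [P i j in LHS](mpolywE lw) raddf_sum /= mulr_suml; apply: eq_bigr => m _.
  by rewrite !mxE mevalZ mevalX mulrAC [RHS]mulrC mulrA.
(* [t0 n] is the [n]-th power of the point with coordinates [2 ^ (w ^ k)], where a monomial takes
   the value 2 to the number whose base [w] digits are its exponents. *)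
pose t0 (n : nat) : 'I_r -> C := fun k => (2%:R ^+ (w ^ k)%N) ^+ n.
have t0G n : Gm (t0 n) by move=> k; rewrite !expf_neq0 // pnatr_eq0.
pose a (m : 'X_{1..r < w}) : C := ((\prod_k t0 1 k) ^+ N)^-1 * mono (t0 1) m.
have p0 : (\prod_k t0 1 k) ^+ N != 0.
  by rewrite expf_neq0 //; apply/prodf_neq0 => k _; apply: t0G.
have a_inj : injective a.
  move=> m m' /(mulfI (invr_neq0 p0)); rewrite /mono.
  have E (n : 'X_{1..r < w}) : \prod_k t0 1 k ^+ n k =
      2%:R ^+ (\sum_k n k * w ^ k) :> C.
    rewrite expr_sum; apply: eq_bigr => k _.
    by rewrite /t0 expr1 -exprM mulnC.
  rewrite !E => /ieexprIn e.
  have {}e : (\sum_k m k * w ^ k = \sum_k m' k * w ^ k)%N.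
    by apply: e; rewrite ?ltr0n ?pnatr_eq1.
  have hw (n : 'X_{1..r < w}) k : (n k < w)%N.
    by apply: leq_ltn_trans (bmdeg n); rewrite mdegE (bigD1 k) //= leq_addr.
  by apply/val_inj/mnmP => k; apply: (digits_inj (hw m) (hw m') e).
have phiX n : val (phi (t0 n)) = (val (phi (t0 1)) : 'M_6) ^+ n.
  have phi1 : val (phi (t0 0)) = 1%:M.
    have := phiM _ _ (t0G 0) (t0G 0).
    have -> : (fun i => t0 0%N i * t0 0%N i) = t0 0.
      by apply/funext => k; rewrite /t0 !expr0 mulr1.
    have u : val (phi (t0 0)) \in unitmx.
      by rewrite unitmxE (eqP (valP (phi _))) unitr1.
    by move=> /(congr1 (mulmx (invmx (val (phi (t0 0)))))); rewrite mulKmx // mulVmx.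
  elim: n => [|n IH]; first exact: phi1.
  rewrite exprS -IH -[RHS]/(_ *m _) -phiM //; congr (val (phi _)).
  by apply/funext => k; rewrite /t0 expr1 exprS.
have phiB n : (val (phi (t0 1)) : 'M_6) ^+ n = \sum_m a m ^+ n *: B m.
  rewrite -phiX phiE //; apply: eq_bigr => m _; congr (_ *: _).
  have t0n k : t0 n k = t0 1 k ^+ n by rewrite /t0 expr1.
  rewrite /a /mono exprMn exprVn; congr (_^-1 * _).
    rewrite [RHS]exprAC -[X in _ = X ^+ N]prodrXl.
    by congr (_ ^+ _); apply: eq_bigr => k _; rewrite t0n.
  by rewrite -prodrXl; apply: eq_bigr => k _; rewrite t0n exprAC.
have [g gu gB] := exponential_sum_diag a_inj phiB.
exists g => // t; rewrite -phiT => -[x xG <-].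
apply/is_diag_mxP => i j ij; rewrite phiE // mulmx_sumr mulmx_suml summxE big1 // => m _.
rewrite -scalemxAr -scalemxAl mxE; have /is_diag_mxP -> // := gB m.
by rewrite mulr0.
Qed.

End MaximalTorus.

(** * Conjugates of the diagonal torus are tori *)

Section ConjTorus.
Variables (R : realType) (g : 'M[R[i]]_6).
Hypothesis gu : g \in unitmx.
Local Notation C := R[i].

(** The off-diagonal entries are the equations of the torus, and the first five diagonal ones invert
    its parametrization. *)
Definition conj_entry (i j : 'I_6) : {mpoly C[6 * 6]} :=
  \sum_a \sum_b (invmx g i a * g b j) *: 'X_(mxvec_index a b).

Lemma conj_entryE i j (h : SL6 R) :
  SL6_eval (conj_entry i j) h = (invmx g *m val h *m g) i j.
Proof.
rewrite /SL6_eval raddf_sum mxE; under [RHS]eq_bigr do rewrite mxE mulr_suml.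
rewrite [RHS]exchange_big /=; apply: eq_bigr => a _; rewrite raddf_sum /=.
apply: eq_bigr => b _; rewrite mevalZ mevalXU mxvecE.
by rewrite mulrAC.
Qed.

Definition det1_diag (t : 'I_5 -> C) (i : 'I_6) : C :=
  oapp t (\prod_k t k)^-1 (unlift ord_max i).

Lemma prod_ord_max (F : 'I_6 -> C) :
  \prod_i F i = \prod_(k < 5) F (lift ord_max k) * F ord_max.
Proof.
rewrite big_ord_recr /=; congr (_ * _); apply: eq_bigr => k _; congr F.
by apply/val_inj; rewrite /= /bump leqNgt ltn_ord.
Qed.

Lemma det1_diag_prod t : Gm t -> \prod_i det1_diag t i = 1.
Proof.
move=> tG; rewrite prod_ord_max /det1_diag unlift_none /=.
under eq_bigr do rewrite liftK /=.
by rewrite mulfV //; apply/prodf_neq0 => k _; apply: tG.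
Qed.

(* Outside [Gm] the value is irrelevant. *)
Definition param_mx (t : 'I_5 -> C) : 'M[C]_6 :=
  if pselect (Gm t) is left _ then g *m diag_of (det1_diag t) *m invmx g else 1%:M.

Lemma param_mxE t : Gm t -> param_mx t = g *m diag_of (det1_diag t) *m invmx g.
Proof. by rewrite /param_mx; case: pselect. Qed.

Lemma det_param t : \det (param_mx t) == 1.
Proof.
rewrite /param_mx; case: pselect => [tG|_]; last by rewrite det1.
rewrite !det_mulmx mulrAC -det_mulmx mulmxV // det1 mul1r det_diag.
by under eq_bigr do rewrite mxE; rewrite det1_diag_prod.
Qed.

Definition param (t : 'I_5 -> C) : SL6 R :=
  exist (fun h : 'M[C]_6 => \det h == 1) _ (det_param t).

Lemma conj_param t : Gm t ->
  invmx g *m val (param t) *m g = diag_of (det1_diag t).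
Proof.
by move=> tG; rewrite /= param_mxE // !mulmxA mulVmx // mul1mx mulmxKV.
Qed.

Lemma conj_torus_is_torus : is_torus (conj_torus g).
Proof.
split.
  exists (fun p => exists i j, i != j /\ p = conj_entry i j).
  apply/seteqP; split=> h /=.
    move=> /is_diag_mxP hd p [i [j [ij ->]]]; rewrite conj_entryE.
    exact: hd.
  move=> hp; apply/is_diag_mxP => i j ij; rewrite -conj_entryE; apply: hp.
  by exists i, j.
exists 5%N, param, (fun i => conj_entry (lift ord_max i) (lift ord_max i)); split.
- apply/seteqP; split=> h /=.
    move=> [t tG <-]; rewrite /conj_torus conj_param //.
    exact: diag_mx_is_diag.
  move=> /(conj_torusP gu)[d d1 hE].
  have d0 i : d i != 0.
    by apply: contra_eq_neq d1 => di; rewrite (bigD1 i) //= di mul0r eq_sym oner_neq0.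
  have tG : Gm (d \o lift ord_max) by move=> k; apply: d0.
  exists (d \o lift ord_max) => //; apply: val_inj; rewrite /= param_mxE // hE.
  congr (_ *m diag_of _ *m _); apply/funext => i; rewrite /det1_diag.
  case: unliftP => [j|] -> //=.
  rewrite prod_ord_max in d1.
  have p0 : \prod_(k < 5) d (lift ord_max k) != 0 by apply/prodf_neq0.
  by apply: (mulfI p0); rewrite mulfV.
- move=> t u tG uG.
  have tuG : Gm (fun i => t i * u i) by move=> k; rewrite mulf_neq0 ?tG ?uG.
  rewrite /= !param_mxE // !mulmxA mulmxKV // -[in RHS](mulmxA g); congr (_ *m _ *m _).
  apply/matrixP => i j; rewrite mul_diag_mx !mxE; have [_|_] := eqVneq i j; last first.
    by rewrite !mulr0n mulr0.
  rewrite !mulr1n /det1_diag; case: unliftP => [k|] _ //=.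
  by rewrite big_split /= invfM.
(* Over the common denominator [\prod_m t m], the first five diagonal entries have numerators
   [t k * \prod_m t m] and the last one has numerator 1. *)
- move=> i j; exists (\sum_l (g i l * invmx g l j) *:
    oapp (fun k => 'X_k * \prod_m 'X_m) 1 (unlift ord_max l)), 1%N => t tG.
  have p0 : \prod_k t k != 0 by apply/prodf_neq0 => k _; apply: tG.
  rewrite /= param_mxE // expr1 mxE raddf_sum mulr_suml; apply: eq_bigr => l _ /=.
  rewrite mul_mx_diag !mxE mevalZ /det1_diag.
  case: unliftP => [k|] _ /=; last by rewrite meval1 mulr1 mulrAC.
  rewrite mevalM mevalXU rmorph_prod /=; under [in RHS]eq_bigr do rewrite mevalXU.
  by rewrite mulrA mulfK // mulrAC.
- move=> t tG i; rewrite conj_entryE conj_param // !mxE eqxx mulr1n.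
  by rewrite /det1_diag liftK.
Qed.

End ConjTorus.

Lemma maximal_torus_conj (R : realType) (T : set (SL6 R)) : maximal_torus T ->
  exists2 g, g \in unitmx & T = conj_torus g.
Proof.
move=> [hT maxT]; have [g gu Tg] := torus_sub_conj hT; exists g => //.
by rewrite (maxT _ (conj_torus_is_torus gu) Tg).
Qed.

Local Open Scope classical_set_scope.

Theorem theorem6p3 (R : realType) (T : set (SL6 R)) (hT : maximal_torus T) :
  coordinate_ring T =
  generated_algebra
    [set F | exists2 k : nat, (k <= 2)%N & homogeneous_element T k F].
Proof.
have [g gu ->] := maximal_torus_conj hT.
exact: coordinate_ring_conj_torus.
Qed.
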